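(* Let $0<m<n$. There is a bijection $\phi$ from $A^0_{(n-m,m)}$ to the set of cylindric shapes $\lambda/d/\emptyset$ with $\lambda\in P_{mn}$ and $d\ge 0$ such that: for $w,v\in A^0_{(n-m,m)}$, the diagram $D_{\phi(v)}$ contains $D_{\phi(w)}$ if and only if $w\le v$ in the weak order of $\widetilde S_n$; and for every $w\in A^0_{(n-m,m)}$ the affine Schur function $F_w$ equals the cylindric Schur function $s_{\phi(w)}$.
   Context: $\widetilde S_n$ is the affine symmetric group with generators $s_i$, $i\in\mathbb Z/n\mathbb Z$ (relations $s_i^2=1$, $s_is_{i+1}s_i=s_{i+1}s_is_{i+1}$, $s_is_j=s_js_i$ for $i-j\ne\pm1$), with length $\ell$. $w$ is $0$-Grassmannian if every nonempty reduced word of $w$ ends with $s_0$. Weak order: generated by $w\lessdot s_iw$ whenever $\ell(s_iw)=\ell(w)+1$. For $J\subsetneq\mathbb Z/n\mathbb Z$, $d_J$ (resp. $u_J$) is the product of the $s_j$, $j\in J$, each once, with $s_{j+1}$ left of $s_j$ (resp. $s_j$ left of $s_{j+1}$) whenever $j,j+1\in J$ (cyclically decreasing, resp. increasing, elements). $w$ is 321-avoiding if no reduced word of $w$ contains a consecutive factor $s_is_{i+1}s_i$. $\mathrm{maxr}(w)$ (resp. $\mathrm{maxc}(w)$) is the largest $|J|$ such that $w=vd_J$ (resp. $w=vu_J$) with $\ell(w)=\ell(v)+|J|$. $A_{(n-m,m)}$ is the set of 321-avoiding $w$ with $\mathrm{maxc}(w)\le m$ and $\mathrm{maxr}(w)\le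 n-m$, and $A^0_{(n-m,m)}$ its subset of $0$-Grassmannian elements. Affine Stanley function: $F_w(\mathbf x)=\sum x_1^{\ell(w_1)}x_2^{\ell(w_2)}\cdots$ over all factorizations $w=w_1w_2\cdots w_l$ into cyclically decreasing elements (identity allowed) with $\sum\ell(w_i)=\ell(w)$; for $0$-Grassmannian $w$ it is called an affine Schur function. Cylindric shapes: $P_{mn}$ is the set of partitions in an $m\times(n-m)$ box; extend $\lambda\in P_{mn}$ by $\lambda_{i+m}=\lambda_i-(n-m)$ and set $\lambda[r]_i=\lambda_{i-r}+r$; $\lambda/d/\emptyset$ ($d\ge0$) has diagram $D_{\lambda/d/\emptyset}$, the set of classes of cells $(i,j)$ with $\emptyset_i<j\le\lambda[d]_i$ modulo $(i,j)\sim(i+m,j-(n-m))$ (so containment of such diagrams means $\lambda[d]_i\le\lambda'[d']_i$ for all $i$). A cylindric semistandard tableau is a map $T$ from these cells to positive integers, constant on classes, with $T(i,j)\le T(i,j+1)$, $T(i,j)<T(i+1,j)$ when both cells are present; $s_{\lambda/d/\emptyset}=\sum_T\prod_c x_{T(c)}$.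
   Formalization: For n = 2 the affine symmetric group is taken to be the infinite dihedral group (no braid relation) and every element counts as 321-avoiding; read literally, the definitions make the set of elements finite for n = 2 and the claim false. For n ≥ 3 nothing is changed. *)

(* Defs.v *)
From HB Require Import structures.
From Stdlib Require Import Relation_Operators.
From mathcomp Require Import all_boot all_fingroup all_algebra.
From mathcomp Require Import finmap.
From mathcomp Require Import boolp classical_sets functions cardinality.

Set Implicit Arguments.
Unset Strict Implicit.
Unset Printing Implicit Defensive.

Local Open Scope ring_scope.
Local Open Scope classical_set_scope.
Local Open Scope quotient_scope.

(* Z/n is 'Z_n, which is the right ring for n >= 2 only; all uses below are
   under 0 < m < n. *)

(* The braid relations are present only for n >= 3: for n = 2 the affine
   symmetric group is the infinite dihedral group, the Coxeter group with
   m(s_0, s_1) = oo. *)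
Inductive cox_rel (n : nat) : seq 'Z_n -> seq 'Z_n -> Prop :=
| cox_square (i : 'Z_n) : cox_rel [:: i; i] [::]
| cox_braid (i : 'Z_n) : (2 < n)%N -> cox_rel [:: i; i + 1; i] [:: i + 1; i; i + 1]
| cox_comm (i j : 'Z_n) : i - j != 1 -> i - j != -1 -> cox_rel [:: i; j] [:: j; i].

Inductive cox_step (n : nat) : seq 'Z_n -> seq 'Z_n -> Prop :=
| CoxStep a u v b : cox_rel u v -> cox_step (a ++ u ++ b) (a ++ v ++ b).

Definition cox_eq (n : nat) : seq 'Z_n -> seq 'Z_n -> Prop :=
  clos_refl_sym_trans _ (@cox_step n).

Section Quotient.
Variable n : nat.
Implicit Types a b c : seq 'Z_n.

Definition cox_eqb a b : bool := `[< cox_eq a b >].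

Lemma cox_eqb_refl : reflexive cox_eqb.
Proof. by move=> a; apply/asboolP; apply: rst_refl. Qed.

Lemma cox_eqb_sym : symmetric cox_eqb.
Proof.
by move=> a b; apply/asboolP/asboolP => ab; apply: rst_sym.
Qed.

Lemma cox_eqb_trans : transitive cox_eqb.
Proof.
move=> b a c /asboolP ab /asboolP bc; apply/asboolP; exact: rst_trans ab bc.
Qed.

Canonical cox_equiv :=
  EquivRel cox_eqb cox_eqb_refl cox_eqb_sym cox_eqb_trans.

Local Notation crepr := generic_quotient.repr.

Definition affS := {eq_quot cox_equiv}.

HB.instance Definition _ := Choice.on affS.
HB.instance Definition _ := EqQuotient.on affS.

Definition affS_pi a : affS := \pi_affS a.

Lemma affS_piP a b : affS_pi a = affS_pi b <-> cox_eq a b.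
Proof.
split; first by move=> /eqquotP/asboolP.
by move=> ab; apply/eqquotP/asboolP.
Qed.

Lemma affS_piK (x : affS) : affS_pi (crepr x) = x.
Proof. exact: reprK. Qed.

Lemma cox_eq_ctx c a b d : cox_eq a b -> cox_eq (c ++ a ++ d) (c ++ b ++ d).
Proof.
elim=> {a b} [_ _ [a u v b uv]|a|a b _ IH|a b e _ IH1 _ IH2].
- apply: rst_step; have := CoxStep (c ++ a) (b ++ d) uv.
  by rewrite !catA.
- exact: rst_refl.
- exact: rst_sym.
- exact: rst_trans IH1 IH2.
Qed.

Lemma cox_eq_cat a a' b b' :
  cox_eq a a' -> cox_eq b b' -> cox_eq (a ++ b) (a' ++ b').
Proof.
move=> aa' bb'; apply: (@rst_trans _ _ _ (a' ++ b)).
  exact: (@cox_eq_ctx [::] a a' b aa').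
by have := @cox_eq_ctx a' b b' [::] bb'; rewrite !cats0.
Qed.

Lemma cox_eq_rev a b : cox_eq a b -> cox_eq (rev a) (rev b).
Proof.
elim=> {a b} [_ _ [a u v b uv]|a|a b _ IH|a b e _ IH1 _ IH2].
- rewrite !rev_cat -!catA; case: uv => [i|i n2|i j ij ji];
    apply: rst_step; apply: CoxStep; rewrite /rev /=.
  + exact: cox_square.
  + exact: cox_braid.
  + by apply: cox_comm; rewrite -GRing.opprB ?GRing.eqr_oppLR ?GRing.opprK.
- exact: rst_refl.
- exact: rst_sym.
- exact: rst_trans IH1 IH2.
Qed.

Lemma cox_eq_catV a : cox_eq (rev a ++ a) [::].
Proof.
elim: a => [|i a IH]; first exact: rst_refl.
rewrite rev_cons cat_rcons.
apply: rst_trans IH; apply: rst_step.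
exact: (@CoxStep n (rev a) [:: i; i] [::] a (cox_square i)).
Qed.

Definition affS_mul (x y : affS) : affS := affS_pi (crepr x ++ crepr y).
Definition affS_one : affS := affS_pi [::].
Definition affS_inv (x : affS) : affS := affS_pi (rev (crepr x)).

Lemma affS_mulE a b : affS_mul (affS_pi a) (affS_pi b) = affS_pi (a ++ b).
Proof. by apply/affS_piP/cox_eq_cat; apply/affS_piP; rewrite affS_piK. Qed.

Lemma affS_invE a : affS_inv (affS_pi a) = affS_pi (rev a).
Proof. by apply/affS_piP/cox_eq_rev; apply/affS_piP; rewrite affS_piK. Qed.

Lemma affS_mulA : associative affS_mul.
Proof.
move=> x y z; rewrite -(affS_piK x) -(affS_piK y) -(affS_piK z).
by rewrite !affS_mulE catA.
Qed.

Lemma affS_mul1 : left_id affS_one affS_mul.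
Proof. by move=> x; rewrite -(affS_piK x) affS_mulE. Qed.

Lemma affS_mulr1 : right_id affS_one affS_mul.
Proof. by move=> x; rewrite -(affS_piK x) affS_mulE cats0. Qed.

Lemma affS_mulV : left_inverse affS_one affS_inv affS_mul.
Proof.
move=> x; rewrite -(affS_piK x) affS_invE affS_mulE.
by apply/affS_piP/cox_eq_catV.
Qed.

Lemma affS_mulrV : right_inverse affS_one affS_inv affS_mul.
Proof.
move=> x; rewrite -(affS_piK x) affS_invE affS_mulE.
by apply/affS_piP; have := cox_eq_catV (rev (crepr x)); rewrite revK.
Qed.

HB.instance Definition _ := isGroup.Build affS
  affS_mulA affS_mul1 affS_mulr1 affS_mulV affS_mulrV.

Definition sgen (i : 'Z_n) : affS := affS_pi [:: i].

Definition word_prod (a : seq 'Z_n) : affS := (\prod_(i <- a) sgen i)%g.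

Lemma word_prodE a : word_prod a = affS_pi a.
Proof.
rewrite /word_prod; elim: a => [|i a IH]; first by rewrite big_nil.
by rewrite big_cons IH; apply: affS_mulE.
Qed.

Lemma word_prod_surj (w : affS) :
  exists k, `[< exists a, size a = k /\ word_prod a = w >].
Proof.
exists (size (crepr w)); apply/asboolP; exists (crepr w).
by rewrite word_prodE affS_piK.
Qed.

Definition ell (w : affS) : nat := ex_minn (word_prod_surj w).

End Quotient.

Section Elements.
Variable n : nat.
Implicit Types (v w x : affS n) (J : {set 'Z_n}) (a : seq 'Z_n).

Definition reduced_word w a := word_prod a = w /\ size a = ell w.

Definition grassmannian0 w :=
  forall a (i : 'Z_n), reduced_word w (rcons a i) -> i = 0.

Definition weak_cover w v := exists i : 'Z_n,
  v = (sgen i * w)%g /\ ell v = (ell w).+1.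

Definition weak_le : affS n -> affS n -> Prop :=
  clos_refl_trans _ weak_cover.

(* [is_d J x] reads x = d_J, [is_u J x] reads x = u_J; all words allowed for a
   given proper subset J differ by commutations, hence give the same x. *)
Definition is_d J x := exists a,
  [/\ uniq a, a =i J,
      forall j : 'Z_n, j \in J -> j + 1 \in J -> (index (j + 1)%R a < index j a)%N
    & x = word_prod a].

Definition is_u J x := exists a,
  [/\ uniq a, a =i J,
      forall j : 'Z_n, j \in J -> j + 1 \in J -> (index j a < index (j + 1)%R a)%N
    & x = word_prod a].

Definition cyc_decreasing x :=
  exists2 J : {set 'Z_n}, J \proper [set: 'Z_n]%SET & is_d J x.

(* For n = 2 there is no braid relation and every element of the affine
   symmetric group (as a permutation of Z) avoids 321; hence the guard. *)
Definition avoids321 w := (2 < n)%N ->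
  forall a (i : 'Z_n), reduced_word w a -> ~~ infix [:: i; i + 1; i] a.

Definition maxr w : nat :=
  \max_(J : {set 'Z_n} | (J \proper [set: 'Z_n]%SET) &&
     `[< exists v d, [/\ is_d J d, w = (v * d)%g & ell w = (ell v + #|J|)%N] >])
   #|J|.

Definition maxc w : nat :=
  \max_(J : {set 'Z_n} | (J \proper [set: 'Z_n]%SET) &&
     `[< exists v u, [/\ is_u J u, w = (v * u)%g & ell w = (ell v + #|J|)%N] >])
   #|J|.

End Elements.

Definition Aset (n m : nat) : set (affS n) :=
  [set w | [/\ avoids321 w, (maxc w <= m)%N & (maxr w <= n - m)%N]].

Definition A0set (n m : nat) : set (affS n) :=
  [set w | Aset m w /\ grassmannian0 w].

(* A monomial prod_i x_{i+1}^{alpha i} is given by its finitely supported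
   exponent vector alpha; a series with natural number coefficients in
   x_1, x_2, ... is the function of its coefficients. *)
Definition monom := {fsfun nat -> nat with 0%N}.
Definition fps := monom -> nat.

(* w = w_1 w_2 ..., with w_{i+1} = f i equal to 1 for all but finitely many i *)
Definition affS_fact (n : nat) := {fsfun nat -> affS n with 1%g}.

Definition factors_prod (n : nat) (f : affS_fact n) : affS n :=
  (\prod_(0 <= i < (\max_(j <- finsupp f) j).+1) f i)%g.

Definition is_fact (n : nat) (w : affS n) (f : affS_fact n) :=
  [/\ forall i, cyc_decreasing (f i),
      factors_prod f = w
    & (\sum_(i <- finsupp f) ell (f i))%N = ell w].

(* The set counted is finite, there being finitely many elements d_J. *)
Definition affine_stanley (n : nat) (w : affS n) : fps := fun alpha =>
  #|` fset_set [set f | is_fact w f /\ forall i, ell (f i) = alpha i]|%fset.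

(* (lambda, d) stands for lambda/d/0, with lambda = (lambda_1, ..., lambda_m) *)
Definition cyl_shape (m : nat) := (m.-tuple nat * nat)%type.

Definition Pmn (m n : nat) : set (m.-tuple nat) :=
  [set la | sorted geq la /\ all (fun x => x <= n - m)%N la].

Definition cyl_shapes (m n : nat) : set (cyl_shape m) :=
  [set s | Pmn n s.1].

(* lambda_i for i in Z; nth counts parts from 0, whence the i - 1 *)
Definition part_ext (m n : nat) (la : m.-tuple nat) (i : int) : int :=
  (nth 0%N la `|((i - 1) %% m%:Z)%Z|%N)%:Z
    - ((i - 1) %/ m%:Z)%Z * (n - m)%N%:Z.

Definition part_shift (m n : nat) (la : m.-tuple nat) (r : nat) (i : int) : int :=
  part_ext n la (i - r%:Z) + r%:Z.

Definition empty_part (m : nat) : m.-tuple nat := [tuple of nseq m 0%N].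

(* the class of c modulo (i, j) ~ (i + m, j - (n - m)) *)
Definition cyl_class (m n : nat) (c : int * int) : set (int * int) :=
  [set c' | exists k : int,
     c' = (c.1 + k * m%:Z, c.2 - k * (n - m)%N%:Z)].

Definition cyl_diagram (m n : nat) (s : cyl_shape m) : set (set (int * int)) :=
  [set cyl_class m n c | c in [set c : int * int |
     part_ext n (empty_part m) c.1 < c.2 /\ c.2 <= part_shift n s.1 s.2 c.1]].

(* A tableau is a function on classes of cells, with value 0 exactly off the
   (finite) diagram. *)
Definition cyl_filling := {fsfun set (int * int) -> nat with 0%N}.

Definition is_cyl_tableau (m n : nat) (s : cyl_shape m) (T : cyl_filling) :=
  let D := cyl_diagram n s in let cl := cyl_class m n in
  [/\ forall c, D c <-> (0 < T c)%N,
      forall i j : int, D (cl (i, j)) -> D (cl (i, j + 1)) ->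
        (T (cl (i, j)) <= T (cl (i, j + 1)%R))%N
    & forall i j : int, D (cl (i, j)) -> D (cl (i + 1, j)) ->
        (T (cl (i, j)) < T (cl (i + 1, j)%R))%N].

(* the exponent of x_k in prod_c x_{T(c)}, for k > 0 *)
Definition filling_exp (T : cyl_filling) (k : nat) : nat :=
  count (fun c => T c == k) (finsupp T).

(* The set counted is finite: the values of T are bounded by the variables
   occurring in the monomial. *)
Definition cyl_schur (m n : nat) (s : cyl_shape m) : fps := fun alpha =>
  #|` fset_set [set T | is_cyl_tableau n s T /\
                        forall i, filling_exp T i.+1 = alpha i]|%fset.

(* Main.v *)
(** A cylindric shape is recorded by its boundary loop: r(c) is the row of the
    last box of content c, so that r(c + n) = r(c) - m and r drops by 0 or 1 at
    each step. Exchanging the two boundary steps around the contents c = i mod n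
    replaces r(c) by r(c - 1) + r(c + 1) - r(c); these linear maps satisfy the
    Coxeter relations, so the affine symmetric group acts on loops, a letter
    changing the number of boxes by at most 1. Call w good if it adds ell(w)
    boxes to the empty shape. Good elements correspond bijectively to the shapes
    containing the empty one: a shape can be built box by box, and any two ways
    of doing so differ by commutations. Good is the same as lying in A^0: if
    prepending i to a reduced word of a good element adds no box, then either
    the length drops, or a factor i (i+1) i appears, or i commutes with
    everything and i = 0, or i = n - m and the first column or the first row
    of the shape is extended beyond the bound on maxc or maxr.

    Multiplying a good element by a cyclically decreasing one, with lengths
    adding up, amounts to adding a horizontal strip. Both F_w and the cylindric
    Schur function therefore count chains of horizontal strips, but with the
    weights in opposite orders, since the leftmost factor of w adds the
    outermost strip. The Bender-Knuth involution repairs this. *)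

Require Import Defs.
From mathcomp Require Import all_boot all_order all_fingroup all_algebra.
From mathcomp Require Import finmap zify ring.
From mathcomp Require Import boolp classical_sets functions cardinality.
From Stdlib Require Import Relation_Operators.

Set Implicit Arguments.
Unset Strict Implicit.
Unset Printing Implicit Defensive.

Import Order.TTheory GRing.Theory Num.Theory.

Local Open Scope ring_scope.

(** * Action of the affine symmetric group on loops *)

(** The length of a group element is given only as a minimum over words. The number of boxes added
    bounds it from below, since a letter adds at most one box per period; a word that adds as many
    boxes as it has letters is therefore reduced, and this is how lengths of good elements are
    computed throughout.

    The hard inclusion, from A^0 to good, inducts along a reduced word read from the right. The part
    already read gives a loop r, and a new letter of content c that adds no box is diagnosed from
    r(c - 1), r(c), r(c + 1). To exhibit a forbidden factor one needs a loop below r that agrees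
    with r at c - 1 and c + 1 and in which the boxes concerned are outermost. It is the minimum of r
    and a translate of [loop0], which is the largest loop with a prescribed bound at one content.

    The group acts in content coordinates, of period n. The Bender-Knuth step needs row coordinates,
    of period m, in which the rows of the middle shape move independently; conjugation of monotone
    functions passes from one to the other. *)

Section Action.
Variable n : nat.
Implicit Types (c d k : int) (a b : seq 'Z_n) (i j : 'Z_n) (r : int -> int).

Definition res c : 'Z_n := c%:~R.

Lemma resD c d : res (c + d) = res c + res d.
Proof. exact: intrD. Qed.

Lemma resB c d : res (c - d) = res c - res d.
Proof. exact: intrB. Qed.

Lemma res1 : res 1 = 1. Proof. by []. Qed.

Lemma res_surj i : exists c, res c = i.
Proof. by exists (i : nat)%:Z; rewrite /res -pmulrn natr_Zp. Qed.

Lemma res_eq0 c : (1 < n)%N -> (res c == 0) = (n%:Z %| c)%Z.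
Proof.
move=> n1; rewrite {1}(divz_eq c n%:Z) /res intrD intrM.
rewrite -[n%:~R]pmulrn pchar_Zp // mulr0 add0r.
have n0 : n%:Z != 0 by lia.
have [k E kn] : exists2 k : nat, (c %% n%:Z)%Z = k%:Z & (k < n)%N.
  exists `|(c %% n%:Z)%Z|%N; have := modz_ge0 c n0; have := ltz_pmod c (d := n%:Z); lia.
rewrite E; rewrite -pmulrn -val_eqE /= val_Zp_nat // modn_small //.
by apply/eqP/dvdz_mod0P; rewrite E; [move=> ->|case].
Qed.

Lemma res_eqP c d : (1 < n)%N -> (res c == res d) <-> exists k, c = d + k * n%:Z.
Proof.
move=> n1; rewrite -subr_eq0 -resB res_eq0 //; split.
  by move/dvdzP => [k e]; exists k; rewrite -e; lia.
by move=> [k ->]; apply/dvdzP; exists k; lia.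
Qed.

Lemma resS_neq c : (res (c + 1) == res c) = false.
Proof. by rewrite resD res1 -subr_eq0 addrAC subrr add0r oner_eq0. Qed.

Lemma resP_neq c : (res (c - 1) == res c) = false.
Proof. by rewrite -{2}(subrK 1 c) eq_sym resS_neq. Qed.

Lemma two_neq0 : (2 < n)%N -> (1 + 1 : 'Z_n) != 0.
Proof.
move=> n2; have := @res_eq0 2 (ltnW n2); rewrite /res -[2%:~R]/(1 + 1) => ->.
by rewrite dvdzE; apply/negP => /dvdn_leq /=; lia.
Qed.

Definition lact1 i r : int -> int :=
  fun c => if res c == i then r (c - 1) + r (c + 1) - r c else r c.

Definition lact a r : int -> int := foldr lact1 r a.

Lemma lact_cat a b r : lact (a ++ b) r = lact a (lact b r).
Proof. by rewrite /lact foldr_cat. Qed.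

Lemma lact1_involutive i : involutive (lact1 i).
Proof.
move=> r; apply/funext => c; rewrite /lact1.
case: eqP => // ci.
rewrite -ci resS_neq resP_neq; lia.
Qed.

Lemma lact1_comm i j r : i - j != 1 -> i - j != -1 ->
  lact1 i (lact1 j r) = lact1 j (lact1 i r).
Proof.
move=> ij1 ij2; apply/funext => c; rewrite /lact1.
have [ci|ci] := eqVneq (res c) i; have [cj|cj] := eqVneq (res c) j => //.
- by have := ci; rewrite cj => <-; rewrite -cj.
- have /negbTE e1 : i - 1 != j by apply: contraNneq ij1 => <-; apply/eqP; ring.
  have /negbTE e2 : i + 1 != j by apply: contraNneq ij2 => <-; apply/eqP; ring.
  by rewrite !resB !resD res1 ci e1 e2.
- have /negbTE e1 : j - 1 != i by apply: contraNneq ij2 => <-; apply/eqP; ring.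
  have /negbTE e2 : j + 1 != i by apply: contraNneq ij1 => <-; apply/eqP; ring.
  by rewrite !resB !resD res1 cj e1 e2.
Qed.

(** In terms of the steps r(c - 1) - r(c), a letter transposes two consecutive steps. Since 2 is not
    0 in Z/n, the contents c - 1 and c + 2 around a pair of classes i, i + 1 stay fixed, and both
    sides reverse the three steps between them. *)
Lemma lact1_braid i r : (2 < n)%N ->
  lact1 i (lact1 (i + 1) (lact1 i r)) = lact1 (i + 1) (lact1 i (lact1 (i + 1) r)).
Proof.
move=> n2; have nz := two_neq0 n2.
have e1 x : (x + 1 == x :> 'Z_n) = false.
  by rewrite -subr_eq0 addrAC subrr add0r oner_eq0.
have e2 x : (x - 1 == x :> 'Z_n) = false.
  by rewrite -{2}(subrK 1 x) eq_sym e1.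
have e3 x : (x - 1 == x + 1 :> 'Z_n) = false.
  apply/negbTE; apply: contraNneq nz => e; apply/eqP.
  by rewrite -[1 + 1](addKr (x - 1)) {1}e; ring.
have e4 x : (x + 1 + 1 == x :> 'Z_n) = false.
  by apply/negbTE; apply: contraNneq nz => e; apply/eqP; rewrite -(subrr x) -{1}e; ring.
apply/funext => c; rewrite /lact1 !(resB, resD, res1).
have [->|ci] := eqVneq (res c) i.
  rewrite !(subrK, addrK, e1, e2, e3, e4, eqxx) [i == _]eq_sym !(e1, e4); lia.
have [->|ci1] := eqVneq (res c) (i + 1) => //.
rewrite !(subrK, addrK, e1, e2, e3, e4, eqxx) [i == _]eq_sym !(e1, e4); lia.
Qed.

Lemma lact_cox_eq a b r : cox_eq a b -> lact a r = lact b r.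
Proof.
elim=> {a b} [_ _ [a u v b uv]|a|a b _ ->|a b e _ -> _ ->] //.
rewrite !lact_cat; congr lact; case: uv => [i|i n2|i j ij ji] /=.
- exact: lact1_involutive.
- exact: lact1_braid.
- exact: lact1_comm.
Qed.

End Action.

(** * Quasi-periodic functions *)

Lemma int_divE (p : nat) (x : int) : (0 < p)%N ->
  exists (e : 'I_p) (k : int), x = e%:Z + k * p%:Z.
Proof.
move=> p0; have pz : p%:Z != 0 by lia.
have lt : (`|(x %% p%:Z)%Z|%N < p)%N.
  by have := modz_ge0 x pz; have := ltz_pmod x (d := p%:Z); lia.
exists (Ordinal lt), (x %/ p%:Z)%Z.
by rewrite /= {1}(divz_eq x p%:Z); have := modz_ge0 x pz; lia.
Qed.

Section QuasiPeriodic.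
Variables p q : nat.
Implicit Types (f : int -> int) (x y k : int).

Definition qper f := forall x, f (x + p%:Z) = f x - q%:Z.
Definition psum f : int := \sum_(x < p) f x%:Z.

Lemma qperM f k x : qper f -> f (x + k * p%:Z) = f x - k * q%:Z.
Proof.
move=> fP.
have pos (j : nat) y : f (y + j%:Z * p%:Z) = f y - j%:Z * q%:Z.
  elim: j y => [|j IH] y; first by rewrite !mul0r addr0 subr0.
  have -> : y + j.+1%:Z * p%:Z = (y + j%:Z * p%:Z) + p%:Z by lia.
  by rewrite fP IH; lia.
case: (lerP 0 k) => k0.
  have -> : k = `|k|%N%:Z by lia.
  exact: pos.
have := pos `|k|%N (x + k * p%:Z).
have -> : x + k * p%:Z + `|k|%N%:Z * p%:Z = x by lia.
by move=> ->; lia.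
Qed.

(** Moving the window by one place trades f(0) for f(p) = f(0) - q. *)
Lemma psum_shift f : qper f -> psum (fun x => f (x + 1)) = psum f - q%:Z.
Proof.
rewrite /psum /qper; case: p => [|p'] fP.
  by rewrite !big_ord0; have := fP 0; rewrite addr0; lia.
rewrite big_ord_recr [in RHS]big_ord_recl /=.
have -> : (p'%:Z + 1) = 0 + p'.+1%:Z by lia.
rewrite fP -[0%Z]/(0 : int) (eq_bigr (fun i : 'I_p' => f (bump 0 i)%:Z)).
  by move: (\sum_(i < p') _) (f 0) => s x; lia.
by move=> i _; congr f; rewrite /= /bump /=; lia.
Qed.

(** Used with p = n for the one content per period that a letter changes, and with p = m for the one
    row per period that it lengthens. *)
Lemma psum_dvd (c : int) : (0 < p)%N -> \sum_(x < p) (p%:Z %| x%:Z - c)%Z%:Z = 1 :> int.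
Proof.
move=> p0; have [e [k ->]] := int_divE c p0.
rewrite (bigD1 e) //= big1 ?addr0.
  have -> : (p%:Z %| e%:Z - (e%:Z + k * p%:Z))%Z.
    by apply/dvdzP; exists (- k); lia.
  by [].
move=> x; rewrite -val_eqE /= => xe.
case: dvdzP => // -[l lE]; exfalso.
have xp := ltn_ord x; have ep := ltn_ord e.
have eq : (l + k) * p%:Z = x%:Z - e%:Z by lia.
have [k0|[k0|k0]] : (l + k < 0) \/ (l + k > 0) \/ (l + k = 0) by lia.
- nia.
- nia.
by rewrite k0 mul0r in eq; move/eqP: xe; apply; lia.
Qed.

End QuasiPeriodic.

(** * Length *)

Section Length.
Variable n : nat.
Implicit Types (a b : seq 'Z_n) (w v x y : affS n) (r : int -> int).

Lemma word_prod_cat a b : word_prod (a ++ b) = (word_prod a * word_prod b)%g.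
Proof. by rewrite /word_prod big_cat. Qed.

Lemma word_prod_cons i b : word_prod (i :: b) = (sgen i * word_prod b)%g.
Proof. by rewrite /word_prod big_cons. Qed.

Lemma word_prod_eq a b : word_prod a = word_prod b <-> cox_eq a b.
Proof. by rewrite !word_prodE; apply: affS_piP. Qed.

Lemma reduced_exists w : exists a, reduced_word w a.
Proof.
rewrite /reduced_word /ell; case: ex_minnP => k /asboolP [a [ak aw]] _.
by exists a.
Qed.

Lemma ell_word_le a : (ell (word_prod a) <= size a)%N.
Proof.
rewrite {1}/ell; case: ex_minnP => k _; apply.
by apply/asboolP; exists a.
Qed.

Lemma ell_mul_le x y : (ell (x * y)%g <= ell x + ell y)%N.
Proof.
have [a [ax sa]] := reduced_exists x; have [b [bx sb]] := reduced_exists y.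
by rewrite -sa -sb -size_cat -ax -bx -word_prod_cat; apply: ell_word_le.
Qed.

Lemma ell1 : ell (1%g : affS n) = 0%N.
Proof.
apply/eqP; rewrite -leqn0; have := @ell_word_le [::]; by rewrite /word_prod big_nil.
Qed.

Lemma ell_eq0 w : ell w = 0%N -> w = 1%g.
Proof.
have [[|i a] [<- /=]] := reduced_exists w; last by move=> <-.
by rewrite /word_prod big_nil.
Qed.

Definition wact w r := lact (generic_quotient.repr w) r.

Lemma wact_word a r : wact (word_prod a) r = lact a r.
Proof.
rewrite /wact; apply/lact_cox_eq/word_prod_eq.
by rewrite [LHS]word_prodE affS_piK.
Qed.

Lemma wactM x y r : wact (x * y)%g r = wact x (wact y r).
Proof.
have [a [<- _]] := reduced_exists x; have [b [<- _]] := reduced_exists y.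
by rewrite -word_prod_cat !wact_word lact_cat.
Qed.

Lemma wact1 r : wact 1%g r = r.
Proof. by have := wact_word [::] r; rewrite /word_prod big_nil. Qed.

(* The function [max(0, c - d)] is fixed by every generator but the one of the
   residue class of [d], so no word avoiding that letter represents it. *)
Lemma sgen_notin_word a i : (1 < n)%N -> i \notin a -> word_prod a <> sgen i.
Proof.
move=> n1 ia e; have [d di] := res_surj i.
pose r (c : int) : int := Num.max 0 (c - d).
have fix_a b : i \notin b -> lact b r = r.
  elim: b => //= j b IH; rewrite inE negb_or => /andP [ij /IH ->].
  apply/funext => c; rewrite /lact1; case: eqP => // cj.
  have : c <> d by move=> cd; rewrite -cj cd di eqxx in ij.
  by rewrite /r; lia.
have := wact_word a r; rewrite fix_a // e.
have -> : sgen i = word_prod [:: i] by rewrite word_prod_cons /word_prod big_nil mulg1.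
rewrite wact_word /= => /(congr1 (fun f => f d)).
rewrite /lact1 di eqxx /r; lia.
Qed.

(** Let b be a reduced word of the same element. If a letter i of a = p1 i p2 were missing from b,
    solving for [sgen i] would express it by p1, b and p2, a word without i. So b contains every
    letter of a. *)
Lemma ell_uniq a : (1 < n)%N -> uniq a -> ell (word_prod a) = size a.
Proof.
move=> n1 ua; apply/eqP; rewrite eqn_leq ell_word_le /=.
have [b [bE <-]] := reduced_exists (word_prod a).
apply: uniq_leq_size => // i /[dup] ia /splitPr.
move=> aE; apply: contrapT => ib; case: aE bE ua => p1 p2 bE.
rewrite cat_uniq /= negb_or => /and3P [_ /andP [i1 _] /andP [i2 _]].
have ib' : i \notin rev p1 ++ b ++ rev p2.
  by rewrite !mem_cat !mem_rev (negbTE i2) (negbTE i1) /= orbF; apply/negP.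
apply: (sgen_notin_word n1 ib').
have Vp (p : seq 'Z_n) : word_prod (rev p) = (word_prod p)^-1%g.
  by rewrite !word_prodE -affS_invE.
by rewrite !word_prod_cat bE word_prod_cat word_prod_cons !Vp !mulgA mulVg mul1g mulgK.
Qed.

End Length.

(** * Conjugate functions and equipotence *)

Definition topof (P : int -> Prop) : int := xget 0 [set t | forall i, P i <-> i <= t]%classic.

Lemma topofP (P : int -> Prop) : (exists t, forall i, P i <-> i <= t) ->
  forall i, P i <-> i <= topof P.
Proof. by move=> ex; apply: (xgetPex 0 ex). Qed.

Lemma cut_exists (P : int -> Prop) (lo hi : int) : P lo -> (forall i, P i -> i <= hi) ->
  (forall i j, i <= j -> P j -> P i) -> exists t, forall i, P i <-> i <= t.
Proof.
move=> Plo Phi Pdown; have [k] : exists k : nat, hi - lo <= k%:Z.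
  by exists `|hi - lo|%N; lia.
elim: k hi Phi => [|k IH] hi Phi hk.
  exists lo => i; split=> [/Phi|]; first by lia.
  by move=> le; apply: Pdown Plo.
have [Ph|nPh] := pselect (P hi).
  by exists hi => i; split=> [/Phi //|le]; apply: Pdown Ph.
apply: (IH (hi - 1)); last by lia.
move=> i Pi; have := Phi _ Pi; suff : i <> hi by lia.
by move=> ih; rewrite ih in Pi.
Qed.

Lemma eq_cut (x y : int) : (forall c, (c <= x) = (c <= y)) -> x = y.
Proof. by move=> e; have := e x; have := e y; lia. Qed.

Definition qanti (p q : nat) (f : int -> int) :=
  qper p q f /\ forall x : int, f (x + 1) <= f x.

(* For a loop r, [conjf r i] is the length of row i minus i. *)
Definition conjf (f : int -> int) (i : int) : int := topof (fun c => i <= f c).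

Lemma qanti_le p q f (x y : int) : qanti p q f -> x <= y -> f y <= f x.
Proof.
move=> [_ fA] xy; have [k ->] : exists k : nat, y = x + k%:Z by exists `|y - x|%N; lia.
elim: k => [|k IH]; first by rewrite addr0.
by apply: le_trans IH; rewrite (_ : x + k.+1%:Z = x + k%:Z + 1) //; lia.
Qed.

(** This Galois connection is what all later facts on conjugates rest on. The maximum in [conjf]
    exists because a decreasing quasi-periodic function with p, q > 0 is unbounded in both
    directions. *)
Lemma conjfP p q f i c : (0 < p)%N -> (0 < q)%N -> qanti p q f ->
  (c <= conjf f i) = (i <= f c).
Proof.
move=> p0 q0 fQ; suff ex : exists t, forall c, i <= f c <-> c <= t.
  by apply/idP/idP => /(topofP ex).
have fM k := qperM k 0 (proj1 fQ); move: (f 0) fM => z fM.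
(* At -K p and K p the function takes the values z + K q and z - K q, which lie on opposite sides of
   i because q is at least 1. *)
pose K := (`|i - z|%N.+1)%:Z.
apply: (@cut_exists _ (0 + (- K) * p%:Z) (0 + K * p%:Z)).
- by rewrite fM /K; nia.
- move=> d dP; rewrite leNgt; apply/negP => lt.
  by have := qanti_le fQ (ltW lt); rewrite fM /K; nia.
by move=> x y xy; have := qanti_le fQ xy; lia.
Qed.

Lemma conjf_qanti p q f : (0 < p)%N -> (0 < q)%N -> qanti p q f -> qanti q p (conjf f).
Proof.
move=> p0 q0 fQ; have cP i c := conjfP i c p0 q0 fQ; split=> i.
  apply: eq_cut => c; rewrite cP lerBrDr cP; have := proj1 fQ c => ->; lia.
by rewrite cP; have := cP (i + 1) (conjf f (i + 1)); rewrite lexx; lia.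
Qed.

Lemma conjfK p q f : (0 < p)%N -> (0 < q)%N -> qanti p q f -> conjf (conjf f) = f.
Proof.
move=> p0 q0 fQ; apply/funext => c; apply: eq_cut => i.
by rewrite (conjfP _ _ q0 p0 (conjf_qanti p0 q0 fQ)) (conjfP _ _ p0 q0 fQ).
Qed.

Definition equipotent T U (A : set T) (B : set U) := exists (f : T -> U) (g : U -> T),
  (forall x, A x -> B (f x) /\ g (f x) = x) /\ (forall y, B y -> A (g y) /\ f (g y) = y).

Lemma equipotent_refl T (A : set T) : equipotent A A.
Proof. by exists id, id. Qed.

Lemma equipotent_trans T U V (B : set U) (A : set T) (C : set V) :
  equipotent A B -> equipotent B C -> equipotent A C.
Proof.
move=> [f [g [fP gP]]] [f' [g' [fP' gP']]]; exists (f' \o f), (g \o g'); split=> x /=.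
  by move=> /fP [/fP' [c e] e']; rewrite e.
by move=> /gP' [/gP [c e] e']; rewrite e.
Qed.

(** Mutually inverse maps also transport infinitude, and [fset_set] sends every infinite set to the
    empty finite set, so both cases give equal cardinals. *)
Lemma equipotent_card (T U : choiceType) (A : set T) (B : set U) : equipotent A B ->
  #|` fset_set A|%fset = #|` fset_set B|%fset.
Proof.
move=> [f [g [fP gP]]].
have BE : B = (f @` A)%classic.
  apply/seteqP; split=> [y /gP [Ay <-]|_ [x /fP [Bx _] <-] //].
  by exists (g y).
have AE : A = (g @` B)%classic.
  apply/seteqP; split=> [x /fP [Bx <-]|_ [y /gP [Ay _] <-] //].
  by exists (f x).
have [Af|Ai] := pselect (finite_set A).
  have Bf : finite_set B by rewrite BE; apply: finite_image.
  apply/(fcard_eq Af Bf); rewrite BE; apply: card_esym; apply: inj_card_eq.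
  by move=> x y /set_mem /fP [_ e] /set_mem /fP [_ e'] h; rewrite -e h e'.
have Bi : ~ finite_set B by move=> Bf; apply: Ai; rewrite AE; apply: finite_image.
by rewrite /fset_set; case: pselect => //; case: pselect.
Qed.

(** * Loops and reduced words *)

Section Cylinder.
Variables m n : nat.
Hypothesis m_gt0 : (0 < m)%N.
Hypothesis m_ltn : (m < n)%N.
Implicit Types (c d k : int) (a b : seq 'Z_n) (i j : 'Z_n) (r : int -> int).

Local Notation lsum := (psum n).

Definition loop r := qper n m r /\ forall c, r (c + 1) <= r c <= r (c + 1) + 1.

Let n_gt1 : (1 < n)%N. Proof. lia. Qed.

Lemma res_per c : res n (c + n%:Z) = res n c.
Proof. by apply/eqP/res_eqP => //; exists 1; rewrite mul1r. Qed.

Lemma loopM r k c : loop r -> r (c + k * n%:Z) = r c - k * m%:Z.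
Proof. by case=> rP _; apply: qperM. Qed.

Lemma loop_step r c : loop r -> r (c + 1) <= r c <= r (c + 1) + 1.
Proof. by case. Qed.

Lemma loop_stepP r c : loop r -> r c <= r (c - 1) <= r c + 1.
Proof. by case=> _ /(_ (c - 1)); rewrite subrK. Qed.

Lemma loop_le r c d : loop r -> c <= d -> r d <= r c <= r d + (d - c).
Proof.
move=> rL cd; have [k ->] : exists k : nat, d = c + k%:Z.
  by exists `|d - c|%N; lia.
elim: k => [|k IH]; first by rewrite addr0; lia.
have -> : c + k.+1%:Z = c + k%:Z + 1 by lia.
by have := loop_step (c + k%:Z) rL; lia.
Qed.

(** The difference of the two steps at c: on a loop it is 1 where a box can be added, -1 where one
    can be removed, and 0 where the boundary goes straight on. *)
Definition second_diff r c : int := r (c - 1) + r (c + 1) - 2 * r c.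

Lemma second_diff_res r c d : loop r -> res n c = res n d ->
  second_diff r c = second_diff r d.
Proof.
move=> rL /eqP /(res_eqP _ _ n_gt1) [k ->]; rewrite /second_diff.
have -> : d + k * n%:Z - 1 = (d - 1) + k * n%:Z by lia.
have -> : d + k * n%:Z + 1 = (d + 1) + k * n%:Z by lia.
by rewrite !loopM //; lia.
Qed.

Lemma lact1E i r c d : loop r -> res n c = i ->
  lact1 i r d = r d + (res n d == i)%:Z * second_diff r c.
Proof.
move=> rL ci; rewrite /lact1; case: eqP => [di|_]; last by rewrite mul0r addr0.
rewrite (@second_diff_res r c d) ?di // /second_diff; lia.
Qed.

Lemma lact1_loop i r : loop r -> loop (lact1 i r).
Proof.
move=> rL; split=> c.
  rewrite /lact1 res_per.
  have -> : c + n%:Z - 1 = (c - 1) + n%:Z by lia.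
  have -> : c + n%:Z + 1 = (c + 1) + n%:Z by lia.
  by case: rL => rP _; rewrite !rP; case: eqP => _; lia.
rewrite /lact1.
have := loop_step c rL; have := loop_step (c + 1) rL; have := loop_stepP c rL.
rewrite addrK.
have [ci|ci] := eqVneq (res n c) i; have [ci'|ci'] := eqVneq (res n (c + 1)) i; try lia.
by have := resS_neq n c; rewrite ci ci' eqxx.
Qed.

Lemma lact_loop a r : loop r -> loop (lact a r).
Proof. by move=> rL; elim: a => //= i a IH; apply: lact1_loop. Qed.

Lemma lsum_lact1 i r c : loop r -> res n c = i ->
  lsum (lact1 i r) = lsum r + second_diff r c.
Proof.
move=> rL ci; rewrite /psum (eq_bigr (fun x : 'I_n => r x%:Z +
    (n%:Z %| x%:Z - c)%Z%:Z * second_diff r c)); last first.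
  move=> x _; rewrite (lact1E _ rL ci) -ci.
  by rewrite -(res_eq0 _ n_gt1) resB subr_eq0.
by rewrite big_split -big_distrl /= psum_dvd ?mul1r //; lia.
Qed.

Lemma lsum_lact_le a r : loop r -> lsum (lact a r) <= lsum r + (size a)%:Z.
Proof.
move=> rL; elim: a => [|i a IH] /=; first by rewrite addr0.
have [c ci] := res_surj i; have aL := lact_loop a rL.
rewrite (lsum_lact1 aL ci) /second_diff.
by have := loop_step c aL; have := loop_stepP c aL; lia.
Qed.

(** As a letter raises the sum by at most 1, equality forces every letter, read from the right, to
    add a box. *)
Definition adding r a := lsum (lact a r) = lsum r + (size a)%:Z.

Lemma adding_cat r a b : loop r ->
  adding r (a ++ b) <-> adding r b /\ adding (lact b r) a.
Proof.
move=> rL; rewrite /adding lact_cat size_cat.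
have := lsum_lact_le b rL; have := lsum_lact_le a (lact_loop b rL); lia.
Qed.

Lemma adding1P r i c : loop r -> res n c = i ->
  adding r [:: i] <-> r (c - 1) = r c + 1 /\ r (c + 1) = r c.
Proof.
move=> rL ci; rewrite /adding /= (lsum_lact1 rL ci) /second_diff.
by have := loop_step c rL; have := loop_stepP c rL; lia.
Qed.

Lemma adding_cons r i b : loop r ->
  adding r (i :: b) <-> adding r b /\ adding (lact b r) [:: i].
Proof. by move=> rL; rewrite -cat1s adding_cat. Qed.

Lemma adding1E r i c : loop r -> adding r [:: i] ->
  lact1 i r c = r c + (res n c == i)%:Z.
Proof.
move=> rL; have [d di] := res_surj i.
rewrite (lact1E _ rL di) /adding /= (lsum_lact1 rL di) => ?.
by rewrite (_ : second_diff r d = 1) ?mulr1 //; lia.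
Qed.

Lemma adding_count r a c : loop r -> adding r a ->
  lact a r c = r c + (count_mem (res n c) a)%:Z.
Proof.
move=> rL; elim: a => [|i a IH]; first by rewrite addr0.
move=> /(adding_cons _ _ rL) [/IH e ai] /=.
by rewrite (adding1E _ (lact_loop a rL) ai) e PoszD addrAC addrA eq_sym.
Qed.

Lemma adding_le r a c : loop r -> adding r a -> r c <= lact a r c.
Proof. by move=> rL /adding_count -> //; lia. Qed.

Lemma loop_ext r r' : loop r -> loop r' ->
  (forall c, 0 <= c < n%:Z -> r c = r' c) -> r = r'.
Proof.
move=> rL rL' e; apply/funext => c; rewrite (divz_eq c n%:Z) addrC.
rewrite !loopM // e // modz_ge0 ?ltz_pmod //; lia.
Qed.

Lemma loop_eq r r' : loop r -> loop r' -> (forall c, r c <= r' c) ->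
  lsum r' <= lsum r -> r = r'.
Proof.
move=> rL rL' le les; apply: loop_ext => // c c0n.
have lt : (`|c|%N < n)%N by lia.
have -> : c = (Ordinal lt : nat)%:Z by rewrite /=; lia.
move: les; rewrite /psum (bigD1 (Ordinal lt)) //= [in X in _ <= X](bigD1 (Ordinal lt)) //=.
have := @ler_sum _ _ (index_enum _) (fun i : 'I_n => i != Ordinal lt)
  (fun i : 'I_n => r i%:Z) (fun i : 'I_n => r' i%:Z) (fun (i : 'I_n) _ => le _).
have := le `|c|%N%:Z.
move: (\sum_(i < n | _) r _) (\sum_(i < n | _) r' _) => x y; lia.
Qed.

(** The last box of content c is removable: the equations say that the box below it, of content c -
    1, and the box to its right, of content c + 1, are absent. *)
Definition corner r c := r (c - 1) = r c /\ r (c + 1) = r c - 1.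

(* [n r(c) + m c] is n-periodic in c and increases along an edge of the loop
   that obstructs the removal of the box at c. *)
Lemma corner_exists r r' : loop r -> loop r' -> (forall c, r c <= r' c) ->
  r <> r' -> exists2 c, r c < r' c & corner r' c.
Proof.
move=> rL rL' le neq.
have [c0 c0P] : exists c0 : 'I_n, r c0%:Z < r' c0%:Z.
  apply: contrapT => /forallNP H; apply: neq; apply: loop_ext => // c c0n.
  have lt : (`|c|%N < n)%N by lia.
  have := H (Ordinal lt); have := le c; rewrite /= (_ : `|c|%N%:Z = c); lia.
pose h (c : int) := n%:Z * r' c + m%:Z * c.
pose P := fun c : 'I_n => r c%:Z < r' c%:Z.
have [c Pc cmax] : exists2 c : 'I_n, P c & forall e : 'I_n, P e -> h e%:Z <= h c%:Z.
  by have [c] := @arg_maxP _ _ _ c0 P (fun e : 'I_n => h e%:Z) c0P; exists c.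
have {}cmax d : r d < r' d -> h d <= h c%:Z.
  have [e [k ->]] := int_divE d (ltnW n_gt1); rewrite /h (loopM _ _ rL) !(loopM _ _ rL') => dP.
  by have := cmax e; rewrite /P /h => /(_ ltac:(lia)); lia.
exists c%:Z => //; rewrite /P in Pc.
have s1 := loop_step c%:Z rL'; have s2 := loop_stepP c%:Z rL'.
have t1 := loop_step c%:Z rL; have t2 := loop_stepP c%:Z rL.
have l1 := le (c%:Z + 1); have l2 := le (c%:Z - 1).
have h1 := cmax (c%:Z + 1); have h2 := cmax (c%:Z - 1).
rewrite /h in h1 h2.
split.
  have [] : r' (c%:Z - 1) = r' c%:Z \/ r' (c%:Z - 1) = r' c%:Z + 1 by lia.
    by [].
  by move=> e; rewrite e in h2 l2; have := h2 ltac:(lia); lia.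
have [] : r' (c%:Z + 1) = r' c%:Z - 1 \/ r' (c%:Z + 1) = r' c%:Z by lia.
  by [].
by move=> e; rewrite e in h1 l1; have := h1 ltac:(lia); lia.
Qed.

Lemma cornerM r c k : loop r -> corner r (c + k * n%:Z) <-> corner r c.
Proof.
move=> rL; rewrite /corner.
have -> : c + k * n%:Z - 1 = (c - 1) + k * n%:Z by lia.
have -> : c + k * n%:Z + 1 = (c + 1) + k * n%:Z by lia.
by rewrite !loopM //; split=> -[]; lia.
Qed.

Lemma corner_lact1 r c d : loop r -> corner r c ->
  lact1 (res n c) r d = r d - (res n d == res n c)%:Z.
Proof.
move=> rL [e1 e2]; rewrite (@lact1E _ _ c) //.
rewrite (_ : second_diff r c = -1); first by lia.
rewrite /second_diff; lia.
Qed.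

Lemma corner_adding r c : loop r -> corner r c ->
  adding (lact1 (res n c) r) [:: res n c].
Proof.
move=> rL [e1 e2]; rewrite /adding /= lact1_involutive (lsum_lact1 rL (erefl _)).
by rewrite /second_diff; lia.
Qed.

Lemma corner_ge r r' c : loop r -> loop r' -> (forall d, r d <= r' d) ->
  r c < r' c -> corner r' c -> forall d, r d <= lact1 (res n c) r' d.
Proof.
move=> rL rL' le lt cc d; rewrite corner_lact1 //.
case: eqP => [|_]; last by have := le d; lia.
by move=> /eqP /(res_eqP _ _ n_gt1) [k ->]; rewrite !loopM //; lia.
Qed.

(** The word is found from its left end: [corner_exists] gives a removable box of r' outside r, and
    the induction is on the number of boxes between the two loops. *)
Lemma adding_exists r r' : loop r -> loop r' -> (forall c, r c <= r' c) ->
  exists2 a, adding r a & lact a r = r'.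
Proof.
move=> rL; have [k] : exists k : nat, lsum r' - lsum r <= k%:Z.
  by exists `|lsum r' - lsum r|%N; lia.
elim: k r' => [|k IH] r' lek rL' le.
  exists [::]; first by rewrite /adding /= addr0.
  by apply: (@loop_eq r r') => //; lia.
have [->|neq] := pselect (r = r').
  by exists [::] => //; rewrite /adding /= addr0.
have [c lt cc] := corner_exists rL rL' le neq.
have [||a aA aE] := IH (lact1 (res n c) r') _ (lact1_loop _ rL').
- rewrite (lsum_lact1 rL' (erefl _)).
  by case: cc => e1 e2; rewrite /second_diff; lia.
- exact: corner_ge.
exists (res n c :: a); last by rewrite /= aE lact1_involutive.
by apply/adding_cons => //; rewrite aE; split=> //; apply: corner_adding.
Qed.

Lemma adding1_corner r i c : loop r -> adding r [:: i] -> res n c = i ->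
  corner (lact1 i r) c /\ r c < lact1 i r c.
Proof.
move=> rL iA ci; rewrite /corner !(adding1E _ rL iA) -ci eqxx resS_neq resP_neq.
by case: (proj1 (adding1P rL ci) iA); lia.
Qed.

Lemma cox_eq_cons i a b : cox_eq a b -> cox_eq (i :: a) (i :: b).
Proof. by move=> ab; apply: (@cox_eq_cat n [:: i] [:: i]) => //; apply: rst_refl. Qed.

(** A diamond argument. If the words start with i and j, different, both letters added corners of
    the same final loop. Corners are never at adjacent contents, so i and j commute; a word e0 for
    the loop with both corners removed links the two through i j e0 and j i e0. *)
Lemma adding_cox_eq r a b : loop r -> adding r a -> adding r b ->
  lact a r = lact b r -> cox_eq a b.
Proof.
move=> rL; have [k] := ubnP (size a); elim: k a b => // k IH a b ak aA bA e.
have sz : size a = size b by move: aA bA; rewrite /adding e; lia.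
case: a b sz ak aA bA e => [|i a] [|j b] //=; first by move=> *; apply: rst_refl.
move=> [sz] ak aiA bjA e.
have [aA iA] := proj1 (adding_cons i a rL) aiA.
have [bA jA] := proj1 (adding_cons j b rL) bjA.
have aL := lact_loop a rL; have bL := lact_loop b rL.
have [ij|ij] := eqVneq i j.
  move: e iA; rewrite ij => e jA'.
  apply/cox_eq_cons/IH => //.
  by rewrite -[LHS](lact1_involutive j) e lact1_involutive.
have [c ci] := res_surj i; have [d dj] := res_surj j.
have [cc cl] := adding1_corner aL iA ci.
have [dc dl] := adding1_corner bL jA dj.
rewrite -e in dc dl.
set r' := lact1 i (lact a r) in e cc cl dc dl.
have rL' : loop r' by apply: lact1_loop.
have leA := adding_le _ rL aA; have leB := adding_le _ rL bA.
have le : forall x, r x <= r' x by move=> x; apply: (adding_le x rL aiA).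
have Dj : forall x, j = res n (c + x) -> exists y, d = c + x + y * n%:Z.
  by move=> x; rewrite -dj => /eqP /(res_eqP _ _ n_gt1).
(* Corners at c - 1 and c would make the step between these contents both 1 and 0. *)
have ij1 : i - j != 1.
  apply/eqP => h; have [|y dE] := Dj (-1).
    by rewrite resB ci res1 -h; ring.
  by move: dc; rewrite dE (cornerM _ _ rL'); move: cc; rewrite /corner subrK; lia.
have ij2 : i - j != -1.
  apply/eqP => h; have [|y dE] := Dj 1.
    by rewrite resD ci res1 -[1]opprK -h; ring.
  by move: dc; rewrite dE (cornerM _ _ rL'); move: cc; rewrite /corner addrK; lia.
have cd : (res n d == res n c) = false by rewrite ci dj eq_sym; apply/negbTE.
have nj : lact1 j r' = lact b r by rewrite e lact1_involutive.
have ni : lact1 i r' = lact a r by rewrite lact1_involutive.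
(* Removing the corner at c changes none of the three values at d - 1, d, d + 1, because the
   residues i and j are neither equal nor adjacent. *)
have dc' : corner (lact a r) d.
  rewrite -ni -ci /corner !corner_lact1 // cd.
  have -> : (res n (d - 1) == res n c) = false.
    apply/negbTE; apply: contraNneq ij2 => h; apply/eqP.
    by rewrite -ci -dj -h resB res1; ring.
  have -> : (res n (d + 1) == res n c) = false.
    apply/negbTE; apply: contraNneq ij1 => h; apply/eqP.
    by rewrite -ci -dj -h resD res1; ring.
  by move: dc; rewrite /corner; lia.
have lt' : r d < lact a r d.
  rewrite -ni -ci corner_lact1 // cd subr0.
  by have := leB d; lia.
(* The loop with both corners removed still contains r. The [eq_ind] merely replaces [res n d] by
   [j]. *)
have [e0 e0A e0E] := adding_exists rL (lact1_loop j aL)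
  (eq_ind _ (fun z => forall x, r x <= lact1 z (lact a r) x)
    (corner_ge rL aL leA lt' dc') _ dj).
have jA' : adding (lact1 j (lact a r)) [:: j] by rewrite -dj; apply: corner_adding.
have com : lact1 i (lact1 j (lact a r)) = lact b r.
  by rewrite lact1_comm // -/r' nj.
have jeA : adding r (j :: e0) by apply/adding_cons => //; rewrite e0E.
have ieA : adding r (i :: e0).
  move: e0A jeA; rewrite /adding /= e0E lact1_involutive com.
  by move: aA bA; rewrite /adding; lia.
apply: (@rst_trans _ _ _ (i :: j :: e0)).
  by apply/cox_eq_cons/IH => //=; rewrite e0E lact1_involutive.
apply: (@rst_trans _ _ _ (j :: i :: e0)).
  apply: rst_step; exact: (@CoxStep n [::] [:: i; j] [:: j; i] e0 (cox_comm ij1 ij2)).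
apply/cox_eq_cons/IH => //=; last by rewrite e0E com.
by move: aA ieA bA; rewrite /adding /= e0E com; lia.
Qed.

(** * The loop of the empty shape, and good elements *)

Let n_gt0 : (0 < n)%N. Proof. exact: ltnW. Qed.

(** In one period the boundary of the empty shape stays in row 0 for the contents 0, ..., n - m,
    then drops one row at each of m steps. That this is the given empty shape is [empty_partE]. *)
Definition loop0 c : int :=
  Num.min 0 (n%:Z - m%:Z - (c %% n%:Z)%Z) - (c %/ n%:Z)%Z * m%:Z.

Lemma loop0E (e : nat) k : (e < n)%N ->
  loop0 (e%:Z + k * n%:Z) = Num.min 0 (n%:Z - m%:Z - e%:Z) - k * m%:Z.
Proof.
move=> en; rewrite /loop0 [e%:Z + _]addrC modzMDl divzMDl; last by lia.
by rewrite modz_small ?divz_small; lia.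
Qed.

Lemma loop0_small c : 0 <= c <= n%:Z -> loop0 c = Num.min 0 (n%:Z - m%:Z - c).
Proof.
move=> cn; have [->|lt] := eqVneq c n%:Z.
  by have := @loop0E 0 1 n_gt0; rewrite add0r mul1r => ->; lia.
have lt' : (`|c|%N < n)%N by lia.
have := @loop0E _ 0 lt'; rewrite mul0r addr0 (_ : `|c|%N%:Z = c); last by lia.
by move=> ->; lia.
Qed.

Lemma loop0_neg c : - n%:Z <= c <= 0 -> loop0 c = Num.min m%:Z (- c).
Proof.
move=> cn; have [->|lt] := eqVneq c 0; first by rewrite loop0_small; lia.
have lt' : (`|(c + n%:Z)%R|%N < n)%N by lia.
have := @loop0E _ (-1) lt'.
rewrite (_ : `|(c + n%:Z)%R|%N%:Z = c + n%:Z); last by lia.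
by rewrite (_ : c + n%:Z + -1 * n%:Z = c) => [->|]; lia.
Qed.

Lemma loop0_loop : loop loop0.
Proof.
split=> c; have [e [k ->]] := int_divE c n_gt0; have en := ltn_ord e.
  have -> : e%:Z + k * n%:Z + n%:Z = e%:Z + (k + 1) * n%:Z by lia.
  by rewrite !loop0E //; lia.
rewrite (loop0E _ en).
have [en1|en1] : (e.+1 < n)%N \/ e.+1 = n by lia.
  have -> : e%:Z + k * n%:Z + 1 = e.+1%:Z + k * n%:Z by lia.
  by rewrite loop0E //; lia.
have -> : e%:Z + k * n%:Z + 1 = 0%N%:Z + (k + 1) * n%:Z by lia.
by rewrite loop0E //; lia.
Qed.

Hint Resolve loop0_loop : core.

(** Over one period such a loop is at most 0 by monotonicity, and going back from r(n) = r(0) - m it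
    rises by at most one row per step. These are the two terms of the minimum in [loop0]. *)
Lemma loop0_max r c : loop r -> r 0 <= 0 -> r c <= loop0 c.
Proof.
move=> rL r0; have [e [k ->]] := int_divE c n_gt0; have en := ltn_ord e.
rewrite (loopM _ _ rL) loop0E //.
have := @loop_le r 0 e%:Z rL; have := @loop_le r e%:Z n%:Z rL.
case: rL => /(_ 0); rewrite add0r; lia.
Qed.

Lemma loop_min r r' : loop r -> loop r' -> loop (fun c => Num.min (r c) (r' c)).
Proof.
move=> [rP rS] [rP' rS']; split=> c; first by rewrite rP rP'; lia.
by have := rS c; have := rS' c; lia.
Qed.

Lemma loop_shift r c k : loop r -> loop (fun d => r (d + c) + k).
Proof.
move=> [rP rS]; split=> d; first by rewrite /= (_ : d + n%:Z + c = d + c + n%:Z) ?rP; lia.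
by have := rS (d + c); rewrite (_ : d + 1 + c = d + c + 1); lia.
Qed.

Lemma corner_loop0 c : corner loop0 c -> exists k, c = n%:Z - m%:Z + k * n%:Z.
Proof.
have [e [k ->]] := int_divE c n_gt0; move/(cornerM _ _ loop0_loop) => [].
have en := ltn_ord e.
rewrite (loop0_small (c := e%:Z)) ?(loop0_small (c := e%:Z + 1)); try lia.
have [e0|e0] : e = 0%N :> nat \/ (0 < e)%N by lia.
  by rewrite e0 loop0_neg; lia.
by rewrite loop0_small => [? ?|]; [exists k|]; lia.
Qed.

Lemma adding_loop0 i : adding loop0 [:: i] -> i = 0.
Proof.
have [c ci] := res_surj i; move/(adding1P loop0_loop ci).
have [e [k eE]] := int_divE c n_gt0; have en := ltn_ord e.
have ei : res n e%:Z = i.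
  by rewrite -ci eE; apply/esym/eqP/res_eqP; [lia|exists k].
rewrite {c ci}eE.
have -> : e%:Z + k * n%:Z - 1 = (e%:Z - 1) + k * n%:Z by lia.
have -> : e%:Z + k * n%:Z + 1 = (e%:Z + 1) + k * n%:Z by lia.
rewrite !(loopM _ _ loop0_loop).
rewrite (loop0_small (c := e%:Z)) ?(loop0_small (c := e%:Z + 1)); try lia.
have [e0|e0] : e = 0%N :> nat \/ (0 < e)%N by lia.
  by rewrite -ei e0.
by rewrite loop0_small => [? |]; lia.
Qed.

Lemma loop0_addable : loop0 (-1) = 1 /\ loop0 0 = 0 /\ loop0 1 = 0.
Proof. by rewrite loop0_neg ?loop0_small ?loop0_small; lia. Qed.

Definition good (w : affS n) := lsum (wact w loop0) = lsum loop0 + (ell w)%:Z.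

Lemma wact_loop (w : affS n) r : loop r -> loop (wact w r).
Proof. exact: lact_loop. Qed.

Lemma good_adding w a : good w -> reduced_word w a -> adding loop0 a.
Proof. by rewrite /good => gw [wa sa]; rewrite /adding sa -gw -wa wact_word. Qed.

(** The length is at most [size a], and at least the number of boxes added, which here is
    [size a]. *)
Lemma adding_good a : adding loop0 a ->
  good (word_prod a) /\ ell (word_prod a) = size a.
Proof.
rewrite /adding /good wact_word => aA.
have [b [bE sb]] := reduced_exists (word_prod a).
have := lsum_lact_le b loop0_loop; rewrite -wact_word bE wact_word.
have := ell_word_le a; lia.
Qed.

Lemma good_suffix x y : good (x * y)%g -> ell (x * y)%g = (ell x + ell y)%N -> good y.
Proof.
have [a [ax sa]] := reduced_exists x; have [b [bx sb]] := reduced_exists y.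
move=> gxy e; have : reduced_word (x * y)%g (a ++ b).
  by rewrite /reduced_word word_prod_cat ax bx size_cat e sa sb.
move/(good_adding gxy)/(adding_cat _ _ loop0_loop) => [].
by move/adding_good => []; rewrite bx.
Qed.

Lemma good_inj w v : good w -> good v -> wact w loop0 = wact v loop0 -> w = v.
Proof.
have [a [ax sa]] := reduced_exists w; have [b [bx sb]] := reduced_exists v.
move=> gw gv; rewrite -ax -bx !wact_word => e; apply/word_prod_eq.
apply: (@adding_cox_eq _ _ _ loop0_loop _ _ e).
  exact: (good_adding gw).
exact: (good_adding gv).
Qed.

Lemma good_exists r : loop r -> (forall c, loop0 c <= r c) ->
  exists2 w, good w & wact w loop0 = r.
Proof.
move=> rL le; have [a aA aE] := adding_exists loop0_loop rL le.
exists (word_prod a); last by rewrite wact_word.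
by case: (adding_good aA).
Qed.

Lemma good_ge w c : good w -> loop0 c <= wact w loop0 c.
Proof.
have [a [ax sa]] := reduced_exists w => gw.
have aA := good_adding gw (conj ax sa).
by rewrite -ax wact_word; apply: adding_le.
Qed.


(** * Strips *)

Lemma psum_le p (f g : int -> int) : (forall c, f c <= g c) -> psum p f <= psum p g.
Proof. by move=> le; apply: ler_sum => i _. Qed.

(** The translate r(c - 1) is the upper bound in [vstrip], so a vertical strip has at most m boxes
    per period; [lsum_succ] gives n - m for horizontal strips in the same way. *)
Lemma lsum_pred r : loop r -> lsum (fun c => r (c - 1)) = lsum r + m%:Z.
Proof.
move=> rL; have rP : qper n m (fun c => r (c - 1)).
  by move=> c; rewrite addrAC; case: rL => ->.
have := psum_shift rP; rewrite /psum.
under [in X in X = _]eq_bigr => i _ do rewrite addrK.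
by move=> ->; rewrite subrK.
Qed.

Lemma lsum_succ r : loop r -> lsum (fun c => r (c + 1) + 1) = lsum r - m%:Z + n%:Z.
Proof.
move=> rL; rewrite /psum big_split /= sumr_const card_ord -(psum_shift (proj1 rL)).
by rewrite /psum natz.
Qed.

(* In content coordinates: a box of r'/r in row x and content c lies below the
   box in row x - 1 and content c + 1, which has to belong to r; for vertical
   strips the box to its left, of content c - 1, has to belong to r. *)
Definition hstrip r r' := forall c, r c <= r' c <= r (c + 1) + 1.
Definition vstrip r r' := forall c, r c <= r' c <= r (c - 1).

(** The loop [r1] is the one on which i acts. As j stands further left it acts later, so neither
    letter has yet changed the contents of these two residues, and addability of i can be read off
    from r itself. *)
Lemma adding_order r a i j : loop r -> adding r a -> uniq a -> i \in a ->
  (index j a < index i a)%N -> exists r1, [/\ loop r1, adding r1 [:: i]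
    & forall c, (res n c == i) || (res n c == j) -> r1 c = r c].
Proof.
move=> rL aA ua ia; case/splitPr: ia ua aA => x y.
rewrite cat_uniq /= negb_or => /and3P [_ /andP [ix /hasPn xy] /andP [iy _]].
move=> /(adding_cat _ _ rL) [/(adding_cons _ _ rL) [yA iA] _].
rewrite !index_cat (negbTE ix) /= eqxx addn0.
case: ifP => [jx _|]; last by rewrite -ltn_subRL subnn.
exists (lact y r); split=> // [|c cij]; first exact: lact_loop.
rewrite (adding_count _ rL yA).
suff -> : count_mem (res n c) y = 0%N by rewrite addr0.
apply/count_memPn; case/orP: cij => /eqP -> //.
by apply/negP => /xy; rewrite /= jx.
Qed.

Lemma adding_uniqE r a c : loop r -> adding r a -> uniq a ->
  lact a r c = r c + (res n c \in a)%:Z.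
Proof. by move=> rL aA ua; rewrite (adding_count _ rL aA) count_uniq_mem. Qed.

(** When the letter of c acts, that of c + 1 has not acted yet, so addability gives r(c + 1) = r(c).
    This contradicts a final value at c above r(c + 1) + 1. *)
Lemma decreasing_hstrip r a : loop r -> adding r a -> uniq a ->
  (forall j, j \in a -> j + 1 \in a -> (index (j + 1)%R a < index j a)%N) ->
  hstrip r (lact a r).
Proof.
move=> rL aA ua ord c; rewrite (adding_le _ rL aA) /= leNgt; apply/negP => lt.
have aL := lact_loop a rL.
have s1 := loop_step c rL; have s2 := loop_step c aL.
have e1 := adding_uniqE c rL aA ua; have e2 := adding_uniqE (c + 1) rL aA ua.
have ca : res n c \in a by move: e1; case: (_ \in a) => //; lia.
have ca1 : res n c + 1 \in a.
  by move: e2; rewrite resD res1; case: (_ \in a) => //; rewrite e1 ca in s2 lt; lia.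
have [r1 [r1L r1A r1E]] := adding_order rL aA ua ca (ord _ ca ca1).
have := proj1 (adding1P r1L (erefl _)) r1A.
rewrite [r1 (c + 1)]r1E ?[r1 c]r1E ?resD ?res1 ?eqxx ?orbT // => -[_].
rewrite e1 ca in lt; lia.
Qed.

Lemma increasing_vstrip r a : loop r -> adding r a -> uniq a ->
  (forall j, j \in a -> j + 1 \in a -> (index j a < index (j + 1)%R a)%N) ->
  vstrip r (lact a r).
Proof.
move=> rL aA ua ord c; rewrite (adding_le _ rL aA) /= leNgt; apply/negP => lt.
have aL := lact_loop a rL.
have s1 := loop_stepP c rL; have s2 := loop_stepP c aL.
have e1 := adding_uniqE c rL aA ua; have e2 := adding_uniqE (c - 1) rL aA ua.
have ca : res n c \in a by move: e1; case: (_ \in a) => //; lia.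
have ca1 : res n (c - 1) \in a.
  by move: e2; case: (_ \in a) => //; rewrite e1 ca in s2 lt; lia.
have ce : res n (c - 1) + 1 = res n c by rewrite resB res1 subrK.
have := ord _ ca1; rewrite ce => /(_ ca) lti.
have [r1 [r1L r1A r1E]] := adding_order rL aA ua ca lti.
have := proj1 (adding1P r1L (erefl _)) r1A.
rewrite [r1 (c - 1)]r1E ?[r1 c]r1E ?eqxx ?orbT // => -[+ _].
rewrite e1 ca in lt; lia.
Qed.

Lemma adding_uniq r a : loop r -> adding r a -> (forall c, lact a r c <= r c + 1) -> uniq a.
Proof.
move=> rL aA le; apply: count_mem_uniq => i; have [c <-] := res_surj i.
have := le c; rewrite (adding_count _ rL aA).
case: (boolP (_ \in a)) => [|/count_memPn -> //].
rewrite -has_pred1 has_count; lia.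
Qed.

Lemma index_lt_total (a : seq 'Z_n) i j : i \in a -> j \in a -> i != j ->
  ~~ (index i a < index j a)%N -> (index j a < index i a)%N.
Proof.
move=> ia ja ij; rewrite -leqNgt leq_eqVlt => /orP [/eqP e|//].
by move: ij; rewrite -(nth_index 0 ia) -(nth_index 0 ja) e eqxx.
Qed.

Lemma succ_neq i : i + 1 != i.
Proof. by rewrite -subr_eq0 addrAC subrr add0r oner_eq0. Qed.

(** If j + 1 acted before j, its addability would give r(c) = r(c + 1) + 1 at a content c of residue
    j, and the box then added at c would leave the strip. *)
Lemma hstrip_word r a : loop r -> adding r a -> hstrip r (lact a r) ->
  uniq a /\ forall j, j \in a -> j + 1 \in a -> (index (j + 1)%R a < index j a)%N.
Proof.
move=> rL aA hs.
have ua : uniq a.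
  by apply: (adding_uniq rL aA) => c; have := hs c; have := loop_step c rL; lia.
split=> // j ja ja1; apply: contrapT => /negP nlt.
have lt := index_lt_total ja1 ja (succ_neq j) nlt.
have [r1 [r1L r1A r1E]] := adding_order rL aA ua ja1 lt.
have [c cj] := res_surj j.
have cj1 : res n (c + 1) = j + 1 by rewrite resD cj.
have := proj1 (adding1P r1L cj1) r1A; rewrite addrK.
rewrite [r1 (c + 1)]r1E ?[r1 c]r1E ?cj ?cj1 ?eqxx ?orbT // => -[+ _].
by have := hs c; rewrite (adding_uniqE c rL aA ua) cj ja; lia.
Qed.

Lemma vstrip_word r a : loop r -> adding r a -> vstrip r (lact a r) ->
  uniq a /\ forall j, j \in a -> j + 1 \in a -> (index j a < index (j + 1)%R a)%N.
Proof.
move=> rL aA hs.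
have ua : uniq a.
  by apply: (adding_uniq rL aA) => c; have := hs c; have := loop_stepP c rL; lia.
split=> // j ja ja1; apply: contrapT => /negP nlt.
have lt := index_lt_total ja ja1 (contra_neq (@esym _ _ _) (succ_neq j)) nlt.
have [r1 [r1L r1A r1E]] := adding_order rL aA ua ja lt.
have [c cj] := res_surj j.
have cj1 : res n (c + 1) = j + 1 by rewrite resD cj.
have := proj1 (adding1P r1L cj) r1A.
rewrite [r1 (c + 1)]r1E ?[r1 c]r1E ?cj ?cj1 ?eqxx ?orbT // => -[_].
by have := hs (c + 1); rewrite addrK (adding_uniqE (c + 1) rL aA ua) cj1 ja1; lia.
Qed.

Lemma loop_vstep r : loop r -> exists c, r c = r (c + 1) + 1.
Proof.
move=> rL; apply: contrapT => /forallNP H.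
have e (k : nat) : r k%:Z = r 0.
  elim: k => // k <-; have := H k%:Z; have := loop_step k%:Z rL.
  by rewrite (_ : k.+1%:Z = k%:Z + 1); lia.
by have := e n; case: rL => /(_ 0); rewrite add0r => -> _; lia.
Qed.

Lemma card_word (J : {set 'Z_n}) a : uniq a -> a =i J -> #|J| = size a.
Proof. by move=> /card_uniqP <- e; apply: eq_card => x; rewrite e. Qed.

(** After i has added a box at content c, a second one there requires a new box at content c - 1.
    For n > 2 the letter i + 1 in between does not act on that content. *)
Lemma good_avoids321 (w : affS n) : good w -> avoids321 w.
Proof.
move=> gw n2 a i /(good_adding gw) aA; apply/negP => /infixP [x [y aE]].
move: aA; rewrite aE => /(adding_cat _ _ loop0_loop) [+ _].
move=> /(adding_cat _ _ loop0_loop) []; set r := lact y _ => _.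
have rL : loop r by apply: lact_loop.
move=> /(adding_cons _ _ rL) [/(adding_cons _ _ rL) [i1 i2] i3].
have [c ci] := res_surj i.
have c1 := proj1 (adding1P rL ci) i1.
have r2L : loop (lact [:: i] r) by apply: lact_loop.
have := proj1 (adding1P (lact_loop [:: i + 1; i] rL) ci) i3.
rewrite /= !(adding1E _ r2L i2) /= !(adding1E _ rL i1) ci eqxx.
rewrite [i == i + 1]eq_sym (negbTE (succ_neq i)) resB ci res1.
have -> : (i - 1 == i + 1) = false.
  apply/negbTE; apply: contraNneq (two_neq0 n2) => e; apply/eqP.
  by rewrite -[1 + 1](addKr (i - 1)) {1}e; ring.
rewrite (_ : (i - 1 == i) = false); first by lia.
by rewrite -{2}(subrK 1 i) eq_sym (negbTE (succ_neq _)).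
Qed.

Lemma good_factor (w v : affS n) a : good w -> w = (v * word_prod a)%g ->
  ell w = (ell v + size a)%N -> adding loop0 a.
Proof.
move=> gw wE le; have [b [bE sb]] := reduced_exists v.
have : reduced_word w (b ++ a).
  by split; [rewrite word_prod_cat bE|rewrite size_cat sb].
by move/(good_adding gw)/(adding_cat _ _ loop0_loop) => [].
Qed.

(** A right factor acts first, so u_J adds a vertical strip to the empty shape itself. *)
Lemma good_maxc (w : affS n) : good w -> (maxc w <= m)%N.
Proof.
move=> gw; apply/bigmax_leqP => J /andP [_ /asboolP [v [u]]].
move=> [[a [ua aJ ord ->]] wE]; rewrite (card_word ua aJ) => le.
have aA := good_factor gw wE le.
have vs : vstrip loop0 (lact a loop0).
  by apply: increasing_vstrip => // j ja ja1; apply: ord; rewrite -aJ.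
have : lsum (lact a loop0) <= lsum (fun c => loop0 (c - 1)).
  by apply: psum_le => c; case/andP: (vs c).
by rewrite lsum_pred // aA; lia.
Qed.

Lemma good_maxr (w : affS n) : good w -> (maxr w <= n - m)%N.
Proof.
move=> gw; apply/bigmax_leqP => J /andP [_ /asboolP [v [u]]].
move=> [[a [ua aJ ord ->]] wE]; rewrite (card_word ua aJ) => le.
have aA := good_factor gw wE le.
have vs : hstrip loop0 (lact a loop0).
  by apply: decreasing_hstrip => // j ja ja1; apply: ord; rewrite -aJ.
have : lsum (lact a loop0) <= lsum (fun c => loop0 (c + 1) + 1).
  by apply: psum_le => c; case/andP: (vs c).
by rewrite lsum_succ // aA; lia.
Qed.

Lemma good_A0 (w : affS n) : good w -> A0set m w.
Proof.
move=> gw; split; first by split; [exact: good_avoids321|exact: good_maxc|exact: good_maxr].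
move=> a i /(good_adding gw); rewrite -cats1 => /(adding_cat _ _ loop0_loop) [].
by move=> /adding_loop0.
Qed.

(** * Elements of A^0 are good *)

Lemma sgen_mul_suffix (v x : affS n) i (k : nat) :
  ell (sgen i * (v * x))%g = (ell (v * x)%g).+1 ->
  ell (v * x)%g = (ell v + k)%N -> (ell x <= k)%N ->
  ell (sgen i * (v * x))%g = (ell (sgen i * v)%g + k)%N.
Proof.
have := ell_mul_le (sgen i * v)%g x; rewrite -mulgA.
have := ell_mul_le (sgen i) v.
have : (ell (sgen i) <= 1)%N.
  by have := ell_word_le [:: i]; rewrite word_prod_cons /word_prod big_nil mulg1.
move: (ell (sgen i * v)%g) (ell (sgen i * (v * x))%g) (ell (v * x)%g).
lia.
Qed.

(** Prepending i turns reduced words of v into reduced words of the product, and length-additive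
    factorizations v = v' u_J or v' d_J into such factorizations with the same J. *)
Lemma A0_suffix (v : affS n) i : A0set m (sgen i * v)%g ->
  ell (sgen i * v)%g = (ell v).+1 -> A0set m v.
Proof.
move=> [[av mc mr] gr] le.
have red a : reduced_word v a -> reduced_word (sgen i * v)%g (i :: a).
  by move=> [va sa]; split; rewrite ?word_prod_cons ?va //= le -sa.
split; last by move=> a j /red /(gr (i :: a)).
split.
- move=> n2 a j /red /(av n2 _ j); apply: contraNN => /infixP [x [y ->]].
  by apply/infixP; exists (i :: x), y.
- apply: leq_trans mc; apply/bigmax_leqP => J /andP [Jp /asboolP [v' [u [uJ vE lv]]]].
  apply: leq_bigmax_cond; rewrite Jp /=; apply/asboolP.
  exists (sgen i * v')%g, u; split=> //; first by rewrite vE mulgA.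
  rewrite vE; apply: sgen_mul_suffix; rewrite -?vE //.
  by case: uJ => a [ua aJ _ ->]; rewrite (card_word ua aJ) ell_word_le.
- apply: leq_trans mr; apply/bigmax_leqP => J /andP [Jp /asboolP [v' [u [uJ vE lv]]]].
  apply: leq_bigmax_cond; rewrite Jp /=; apply/asboolP.
  exists (sgen i * v')%g, u; split=> //; first by rewrite vE mulgA.
  rewrite vE; apply: sgen_mul_suffix; rewrite -?vE //.
  by case: uJ => a [ua aJ _ ->]; rewrite (card_word ua aJ) ell_word_le.
Qed.

Lemma cox_eq_comm_word i b : i + 1 \notin b -> i - 1 \notin b ->
  cox_eq (i :: b) (rcons b i).
Proof.
elim: b => [|j b IH]; first by move=> *; apply: rst_refl.
rewrite !inE !negb_or => /andP [ij1 ib1] /andP [ij2 ib2] /=.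
apply: (@rst_trans _ _ _ (j :: i :: b)); last exact/cox_eq_cons/IH.
apply: rst_step; apply: (@CoxStep n [::] [:: i; j] [:: j; i] b); apply: cox_comm.
  by apply: contraNneq ij2 => <-; apply/eqP; ring.
by apply: contraNneq ij1 => e; apply/eqP; rewrite -[1]opprK -e; ring.
Qed.

(** An intermediate loop r' that agrees with the final one at c - 1 and c + 1 leaves no letter of
    these residues in b1, so the letter of c moves to the right past b1. *)
Lemma adding_commute r' b b1 b2 c : loop r' -> adding loop0 b -> adding loop0 b2 ->
  lact b2 loop0 = r' -> adding r' b1 -> lact b1 r' = lact b loop0 ->
  r' (c - 1) = lact b loop0 (c - 1) -> r' (c + 1) = lact b loop0 (c + 1) ->
  cox_eq (res n c :: b) (b1 ++ res n c :: b2) /\ (size b = size b1 + size b2)%N.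
Proof.
move=> rL' bA b2A b2E b1A b1E e1 e2.
have ni d : r' d = lact b loop0 d -> res n d \notin b1.
  by move=> e; apply/count_memPn; have := adding_count d rL' b1A; rewrite b1E -e; lia.
have bbA : adding loop0 (b1 ++ b2) by apply/adding_cat => //; rewrite b2E.
have bE : cox_eq b (b1 ++ b2).
  by apply: (adding_cox_eq loop0_loop) => //; rewrite lact_cat b2E.
split; last by move: bA bbA; rewrite /adding lact_cat b2E b1E size_cat; lia.
apply: (@rst_trans _ _ _ (res n c :: b1 ++ b2)); first exact: cox_eq_cons.
rewrite -[b1 ++ _ :: b2]cat_rcons; apply: (@cox_eq_cat n (res n c :: b1) _ b2).
  apply: cox_eq_comm_word; first by rewrite -res1 -resD; apply: ni.
  by rewrite -res1 -resB; apply: ni.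
exact: rst_refl.
Qed.

Definition reduced a := size a = ell (word_prod a).

Lemma reduced_cox_eq a b : reduced a -> cox_eq a b -> size a = size b ->
  reduced_word (word_prod a) b.
Proof. by move=> ra /word_prod_eq e sab; split; rewrite -?e -?ra. Qed.

Lemma reduced_shorter i b b2 : reduced (i :: b) -> size b = (size b2).+1 ->
  cox_eq b (i :: b2) -> False.
Proof.
move=> ib sb e; have /word_prod_eq e2 : cox_eq (i :: b) b2.
  apply: (@rst_trans _ _ _ [:: i, i & b2]); first exact: cox_eq_cons.
  by apply: rst_step; apply: (@CoxStep n [::] [:: i; i] [::] b2); apply: cox_square.
by move: ib; rewrite /reduced e2 /=; have := ell_word_le b2; lia.
Qed.

(* [r'] is the shape cut out of [r] so that the boxes of residue [j], [i] come
   last; what lies above commutes with [i], so prepending [i] yields [i j i]. *)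
Lemma flat_braid r' b c j : loop r' -> adding loop0 b -> (forall d, loop0 d <= r' d) ->
  (forall d, r' d <= lact b loop0 d) ->
  r' (c - 1) = lact b loop0 (c - 1) -> r' (c + 1) = lact b loop0 (c + 1) ->
  (forall d, loop0 d <= lact [:: res n c; j] r' d) ->
  adding (lact [:: res n c; j] r') [:: j; res n c] ->
  exists b1 b2, cox_eq (res n c :: b) (b1 ++ [:: res n c; j; res n c] ++ b2)
    /\ (size b = size b1 + size b2 + 2)%N.
Proof.
move=> rL' bA ge le e1 e2 ge2 ciA; have bL := lact_loop b loop0_loop.
have pL : loop (lact [:: res n c; j] r') by apply: lact_loop.
have [b2 b2A b2E] := adding_exists loop0_loop pL ge2.
have [b1 b1A b1E] := adding_exists rL' bL le.
have b2A' : adding loop0 ([:: j; res n c] ++ b2).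
  by apply/adding_cat => //; rewrite b2E.
have b2E' : lact ([:: j; res n c] ++ b2) loop0 = r'.
  by rewrite lact_cat b2E /= !lact1_involutive.
have [ce sz] := adding_commute rL' bA b2A' b2E' b1A b1E e1 e2.
by exists b1, b2; split=> //; rewrite sz /=; lia.
Qed.

(** The last boxes of contents c and c + 1 are neighbours in row [r c]. When they are the last two
    added, prepending the letter of c produces the factor c (c + 1) c. *)
Lemma flat_horizontal b c : adding loop0 b -> reduced (res n c :: b) ->
  avoids321 (word_prod (res n c :: b)) -> loop0 c < lact b loop0 c ->
  lact b loop0 (c - 1) = lact b loop0 c -> lact b loop0 (c + 1) = lact b loop0 c -> False.
Proof.
move=> bA red av; set r := lact b loop0 => lt e1 e2.
have rL : loop r by apply: lact_loop.
(* For n = 2 the contents c - 1 and c + 1 are one period apart, so their values differ by m > 0. *)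
have n2 : (2 < n)%N.
  rewrite ltnNge; apply/negP => n2.
  have := @loop_le r (c + 1) (c - 1 + n%:Z) rL ltac:(lia).
  by case: rL => -> _; lia.
(* By [loop0_max] the second loop is the largest one with value at most r(c) - 1 at c + 2. The cut
   removes what blocks the box of content c + 1 in row r(c). *)
pose r' := fun d => Num.min (r d) (loop0 (d + (- c - 2)) + (r c - 1)).
have rL' : loop r' by apply: loop_min => //; apply: loop_shift.
have l0 : forall d, loop0 d <= r d by move=> d; apply: adding_le.
have ge : forall d, loop0 d <= r' d.
  move=> d; rewrite /r' le_min l0 /=.
  have := @loop0_max (fun d => loop0 (d + (c + 2)) + (1 - r c)) (d + (- c - 2))
    (loop_shift _ _ loop0_loop).
  rewrite add0r (_ : d + (- c - 2) + (c + 2) = d); last by lia.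
  have := @loop_le loop0 c (c + 2) loop0_loop ltac:(lia); lia.
have v1 : r' (c + 1) = r c.
  rewrite /r' e2 (_ : c + 1 + (- c - 2) = -1); last by lia.
  by have [-> _] := loop0_addable; lia.
have big d : d <= -1 -> 1 <= loop0 d.
  by move=> dl; have := @loop_le loop0 d (-1) loop0_loop dl; have [-> _] := loop0_addable; lia.
have v0 : r' c = r c by rewrite /r'; have := big (c + (- c - 2)); lia.
have vm : r' (c - 1) = r c by rewrite /r' e1; have := big (c - 1 + (- c - 2)); lia.
have v2 : r' (c + 2) = r c - 1.
  rewrite /r' (_ : c + 2 + (- c - 2) = 0); last by lia.
  have [_ [-> _]] := loop0_addable; have := loop_step (c + 1) rL.
  by rewrite (_ : c + 1 + 1 = c + 2); lia.
have cr1 : corner r' (c + 1).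
  by split; rewrite ?addrK ?v0 ?v1 // (_ : c + 1 + 1 = c + 2) ?v2; lia.
pose r1 := lact1 (res n (c + 1)) r'.
have r1L : loop r1 by apply: lact1_loop.
have cm1 : (res n (c - 1) == res n (c + 1)) = false.
  apply/negbTE; apply: contraNneq (two_neq0 n2); rewrite resB resD res1 => e; apply/eqP.
  by rewrite -[1 + 1](addKr (res n c - 1)) {1}e; ring.
have cr0 : corner r1 c.
  split; rewrite /r1 !corner_lact1 // ?v0 ?v1 ?vm ?cm1 ?[res n c == _]eq_sym
    ?resS_neq ?eqxx /=; lia.
have ge1 : forall d, loop0 d <= r1 d.
  apply: (corner_ge loop0_loop rL' ge) => //.
  by rewrite v1; have := loop_step c loop0_loop; lia.
have ge2 : forall d, loop0 d <= lact1 (res n c) r1 d.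
  apply: (corner_ge loop0_loop r1L ge1) => //.
  by rewrite /r1 corner_lact1 // [res n c == _]eq_sym resS_neq v0; lia.
have le' : forall d, r' d <= r d by move=> d; rewrite /r' ge_min lexx.
have ad : adding (lact [:: res n c; res n (c + 1)] r') [:: res n (c + 1); res n c].
  apply/adding_cons; first exact: lact_loop.
  split; first exact: (corner_adding r1L cr0).
  by rewrite /= lact1_involutive; apply: (corner_adding rL' cr1).
have [b1 [b2 [ce sz]]] := flat_braid rL' bA ge le'
  (etrans vm (esym e1)) (etrans v1 (esym e2)) ge2 ad.
have := reduced_cox_eq red ce; rewrite /= !size_cat /= sz => /(_ ltac:(lia)).
move=> /(av n2 _ (res n c)) /negP; apply.
by apply/infixP; exists b1, b2; rewrite resD res1.
Qed.

(** Here the last box of content c - 1 lies directly below that of content c, and the factor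
    obtained is c (c - 1) c. *)
Lemma flat_vertical b c : adding loop0 b -> reduced (res n c :: b) ->
  avoids321 (word_prod (res n c :: b)) -> loop0 c < lact b loop0 c ->
  lact b loop0 (c - 1) = lact b loop0 c + 1 ->
  lact b loop0 (c + 1) = lact b loop0 c - 1 -> False.
Proof.
move=> bA red av; set r := lact b loop0 => lt e1 e2.
have rL : loop r by apply: lact_loop.
have n2 : (2 < n)%N.
  rewrite ltnNge; apply/negP => n2.
  have := @loop_le r (c - 1 + n%:Z) (c + 1) rL ltac:(lia).
  by case: rL => -> _; lia.
(* The second loop is the largest one with value at most r(c) + 1 at c - 2; it frees the box of
   content c - 1 in row r(c) + 1. *)
pose r' := fun d => Num.min (r d) (loop0 (d + (2 - c)) + (r c + 1)).
have rL' : loop r' by apply: loop_min => //; apply: loop_shift.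
have l0 : forall d, loop0 d <= r d by move=> d; apply: adding_le.
have ge : forall d, loop0 d <= r' d.
  move=> d; rewrite /r' le_min l0 /=.
  have := @loop0_max (fun d => loop0 (d + (c - 2)) + (- 1 - r c)) (d + (2 - c))
    (loop_shift _ _ loop0_loop).
  rewrite add0r (_ : d + (2 - c) + (c - 2) = d); last by lia.
  have := @loop_le loop0 (c - 2) c loop0_loop ltac:(lia); lia.
have big d : 1 <= d -> 1 - d <= loop0 d.
  by move=> dl; have := @loop_le loop0 1 d loop0_loop dl; have [_ [_ ->]] := loop0_addable; lia.
have v1 : r' (c - 1) = r c + 1.
  rewrite /r' e1 (_ : c - 1 + (2 - c) = 1); last by lia.
  by have [_ [_ ->]] := loop0_addable; lia.
have v0 : r' c = r c by rewrite /r'; have := big (c + (2 - c)); lia.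
have vm : r' (c + 1) = r c - 1 by rewrite /r' e2; have := big (c + 1 + (2 - c)); lia.
have v2 : r' (c - 2) = r c + 1.
  rewrite /r' (_ : c - 2 + (2 - c) = 0); last by lia.
  have [_ [-> _]] := loop0_addable; have := loop_stepP (c - 1) rL.
  by rewrite (_ : c - 1 - 1 = c - 2); lia.
have cr1 : corner r' (c - 1).
  have h : c - 1 - 1 = c - 2 by lia.
  by rewrite /corner h subrK v0 v1 v2; lia.
pose r1 := lact1 (res n (c - 1)) r'.
have r1L : loop r1 by apply: lact1_loop.
have cm1 : (res n (c + 1) == res n (c - 1)) = false.
  apply/negbTE; apply: contraNneq (two_neq0 n2); rewrite resB resD res1 => e; apply/eqP.
  by rewrite -[1 + 1](addKr (res n c - 1)) -{1}e; ring.
have cr0 : corner r1 c.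
  split; rewrite /r1 !corner_lact1 // ?v0 ?v1 ?vm ?cm1 ?[res n c == _]eq_sym
    ?resP_neq ?eqxx /=; lia.
have ge1 : forall d, loop0 d <= r1 d.
  apply: (corner_ge loop0_loop rL' ge) => //.
  by rewrite v1; have := loop_stepP c loop0_loop; lia.
have ge2 : forall d, loop0 d <= lact1 (res n c) r1 d.
  apply: (corner_ge loop0_loop r1L ge1) => //.
  by rewrite /r1 corner_lact1 // [res n c == _]eq_sym resP_neq v0; lia.
have le' : forall d, r' d <= r d by move=> d; rewrite /r' ge_min lexx.
have ad : adding (lact [:: res n c; res n (c - 1)] r') [:: res n (c - 1); res n c].
  apply/adding_cons; first exact: lact_loop.
  split; first exact: (corner_adding r1L cr0).
  by rewrite /= lact1_involutive; apply: (corner_adding rL' cr1).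
have [b1 [b2 [ce sz]]] := flat_braid rL' bA ge le'
  (etrans v1 (esym e1)) (etrans vm (esym e2)) ge2 ad.
pose j := res n (c - 1).
have ij : res n c = j + 1 by rewrite /j resB res1 subrK.
(* [avoids321] names only the factors j (j + 1) j, so a braid move is applied to (j + 1) j (j +
   1). *)
have {}ce : cox_eq (res n c :: b) (b1 ++ [:: j; j + 1; j] ++ b2).
  apply: rst_trans ce _; rewrite ij; apply: cox_eq_ctx.
  by apply: rst_sym; apply: rst_step; apply: (CoxStep [::] [::] (cox_braid j n2)).
have := reduced_cox_eq red ce; rewrite /= !size_cat /= sz => /(_ ltac:(lia)).
by move=> /(av n2 _ j) /negP; apply; apply/infixP; exists b1, b2.
Qed.

(* [n - m] is the content of the inner corner of the empty shape; the loop of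
   the first column is the translate of the empty loop by one content, that of
   the first row its translate by one content and one row. *)
Lemma boundary_maxc b : adding loop0 b -> reduced (res n (n%:Z - m%:Z) :: b) ->
  lact b loop0 (n%:Z - m%:Z) = 0 -> lact b loop0 (n%:Z - m%:Z - 1) = 0 ->
  lact b loop0 (n%:Z - m%:Z + 1) = 0 ->
  (m < maxc (word_prod (res n (n%:Z - m%:Z) :: b)))%N.
Proof.
set c := n%:Z - m%:Z; set r := lact b loop0 => bA red e0 em ep.
have rL : loop r by apply: lact_loop.
(* Two of the n steps of a period are flat, so the m drops fit into n - 2 steps. This makes a set of
   m + 1 residues proper. *)
have mn1 : (m.+1 < n)%N.
  have := @loop_le r (c + 1) (c - 1 + n%:Z) rL ltac:(lia).
  by case: rL => -> _; lia.
pose col := fun d => loop0 (d - 1).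
have colL : loop col.
  have := loop_shift (-1) 0 loop0_loop; congr loop; apply/funext => d.
  by rewrite addr0.
have le0 : forall d, loop0 d <= col d.
  by move=> d; rewrite /col; have := loop_stepP d loop0_loop; lia.
have l0 : forall d, loop0 d <= r d by move=> d; apply: adding_le.
(* The value r(c + 1) = 0 puts the box of content c + 1 in row 0 into the shape. It is the lowest of
   the m boxes of a first column, so the whole column is there. *)
have lec : forall d, col d <= r d.
  move=> d; have [e [k ->]] := int_divE d n_gt0; have en := ltn_ord e.
  rewrite !loopM //; suff : col e%:Z <= r e%:Z by lia.
  have [e1|e1] : (e%:Z <= c) \/ (c + 1 <= e%:Z) by lia.
    have [e2|e2] : e%:Z = 0 \/ 0 < e%:Z by lia.
      have := @loop_le r (c + 1) n%:Z rL ltac:(lia).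
      rewrite e2 /col sub0r; have [-> _] := loop0_addable.
      by have := (proj1 rL) 0; rewrite add0r; lia.
    have := l0 e%:Z; rewrite /col !loop0_small; lia.
  have := @loop_le r (c + 1) e%:Z rL e1.
  by rewrite /col loop0_small; lia.
have [k kA kE] := adding_exists loop0_loop colL le0.
have [b1 b1A b1E] := adding_exists colL rL lec.
have vp : col (c + 1) = r (c + 1) by rewrite /col addrK ep loop0_small; lia.
have vm : col (c - 1) = r (c - 1) by rewrite /col em loop0_small; lia.
have [ce sz] := adding_commute colL bA kA kE b1A b1E vm vp.
have vs : vstrip loop0 (lact k loop0).
  by move=> d; rewrite kE le0 lexx.
have [uk ord] := vstrip_word loop0_loop kA vs.
have mem d : res n d \in k -> col d = loop0 d + 1.
  by have := adding_uniqE d loop0_loop kA uk; rewrite kE => + h; rewrite h.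
have ck : res n c \notin k by apply/negP => /mem; rewrite /col !loop0_small; lia.
(* With c at the head, an increasing word may contain c + 1 but not c - 1 to its right. *)
have cmk : res n (c - 1) \notin k by apply/negP => /mem; rewrite /col !loop0_small; lia.
have sk : size k = m.
  by have := kA; rewrite /adding kE [in LHS]/col lsum_pred //; lia.
have uik : uniq (res n c :: k) by rewrite /= ck.
pose J : {set 'Z_n} := [set x in res n c :: k].
have JE : res n c :: k =i J by move=> x; rewrite finset.in_set.
have cJ : #|J| = m.+1 by rewrite (card_word uik JE) /= sk.
have ww : word_prod (res n c :: b) = (word_prod b1 * word_prod (res n c :: k))%g.
  by rewrite -word_prod_cat; apply/word_prod_eq.
rewrite -cJ; apply: leq_bigmax_cond; apply/andP; split.
  by rewrite properEcard finset.subsetT cardsT card_ord cJ Zp_cast.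
apply/asboolP; exists (word_prod b1), (word_prod (res n c :: k)); split=> //.
  exists (res n c :: k); split=> // j; rewrite -!JE !inE.
  have [-> _|jc] := eqVneq j (res n c) => /=.
    by rewrite eqxx [res n c == _ + 1]eq_sym (negbTE (succ_neq _)).
  rewrite [res n c == j]eq_sym (negbTE jc) [res n c == _]eq_sym => jk.
  have [jc1|_] /= := eqVneq (j + 1) (res n c).
    by move: cmk; rewrite resB res1 -jc1 addrK jk.
  by move=> jk1; rewrite ltnS; apply: ord.
have := ell_mul_le (word_prod b1) (word_prod (res n c :: k)); rewrite -ww.
have := ell_word_le b1; have := ell_word_le (res n c :: k).
by rewrite -red cJ /= sz sk; lia.
Qed.

Lemma boundary_maxr b : adding loop0 b -> reduced (res n (n%:Z - m%:Z) :: b) ->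
  lact b loop0 (n%:Z - m%:Z) = 0 -> lact b loop0 (n%:Z - m%:Z - 1) = 1 ->
  lact b loop0 (n%:Z - m%:Z + 1) = - 1 ->
  (n - m < maxr (word_prod (res n (n%:Z - m%:Z) :: b)))%N.
Proof.
set c := n%:Z - m%:Z; set r := lact b loop0 => bA red e0 em ep.
have rL : loop r by apply: lact_loop.
(* Both steps at c are drops, so a period has at least two of them, and a set of n - m + 1 residues
   is proper. *)
have mn1 : (1 < m)%N.
  have := @loop_le r (c + 1) (c - 1 + n%:Z) rL ltac:(lia).
  by case: rL => -> _; lia.
pose row := fun d => loop0 (d + 1) + 1.
have rowL : loop row by apply: loop_shift.
have le0 : forall d, loop0 d <= row d.
  by move=> d; rewrite /row; have := loop_step d loop0_loop; lia.
have l0 : forall d, loop0 d <= r d by move=> d; apply: adding_le.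
(* The value r(c - 1) = 1 puts the last box of the first row, of content n - m - 1 in row 1, into
   the shape. *)
have ler : forall d, row d <= r d.
  move=> d; have [e [k ->]] := int_divE d n_gt0; have en := ltn_ord e.
  rewrite !loopM //; suff : row e%:Z <= r e%:Z by lia.
  have [e1|e1] : (e%:Z <= c - 1) \/ (c <= e%:Z) by lia.
    have := @loop_le r e%:Z (c - 1) rL e1.
    by rewrite /row loop0_small; lia.
  by have := l0 e%:Z; rewrite /row !loop0_small; lia.
have [k kA kE] := adding_exists loop0_loop rowL le0.
have [b1 b1A b1E] := adding_exists rowL rL ler.
have vp : row (c + 1) = r (c + 1) by rewrite /row ep loop0_small; lia.
have vm : row (c - 1) = r (c - 1) by rewrite /row em subrK loop0_small; lia.
have [ce sz] := adding_commute rowL bA kA kE b1A b1E vm vp.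
have vs : hstrip loop0 (lact k loop0).
  by move=> d; rewrite kE le0 lexx.
have [uk ord] := hstrip_word loop0_loop kA vs.
have mem d : res n d \in k -> row d = loop0 d + 1.
  by have := adding_uniqE d loop0_loop kA uk; rewrite kE => + h; rewrite h.
have ck : res n c \notin k by apply/negP => /mem; rewrite /row !loop0_small; lia.
(* Dually to the column case, a decreasing word with c at the head must not contain c + 1 to its
   right. *)
have cpk : res n (c + 1) \notin k by apply/negP => /mem; rewrite /row !loop0_small; lia.
have sk : size k = (n - m)%N.
  by have := kA; rewrite /adding kE [in LHS]/row lsum_succ //; lia.
have uik : uniq (res n c :: k) by rewrite /= ck.
pose J : {set 'Z_n} := [set x in res n c :: k].
have JE : res n c :: k =i J by move=> x; rewrite finset.in_set.
have cJ : #|J| = (n - m).+1 by rewrite (card_word uik JE) /= sk.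
have ww : word_prod (res n c :: b) = (word_prod b1 * word_prod (res n c :: k))%g.
  by rewrite -word_prod_cat; apply/word_prod_eq.
rewrite -cJ; apply: leq_bigmax_cond; apply/andP; split.
  by rewrite properEcard finset.subsetT cardsT card_ord cJ Zp_cast //; lia.
apply/asboolP; exists (word_prod b1), (word_prod (res n c :: k)); split=> //.
  exists (res n c :: k); split=> // j; rewrite -!JE !inE.
  have [-> _|jc] := eqVneq j (res n c) => /=.
    by rewrite (negbTE (succ_neq _)) /= -res1 -resD (negbTE cpk).
  move=> jk; rewrite [res n c == j]eq_sym (negbTE jc) [res n c == _]eq_sym.
  by case: eqP => //= _ jk1; rewrite ltnS; apply: ord.
have := ell_mul_le (word_prod b1) (word_prod (res n c :: k)); rewrite -ww.
have := ell_word_le b1; have := ell_word_le (res n c :: k).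
by rewrite -red cJ /= sz sk; lia.
Qed.

(** Suppose no box is added at c. If content c already has a new box, a straight boundary gives a
    321 factor and a corner makes the length drop. If it has none, either its neighbours have none
    and i commutes with b, or c is the corner of the empty shape and the first column or row is
    exceeded. *)
Lemma A0_addable i b : adding loop0 b -> reduced (i :: b) ->
  A0set m (word_prod (i :: b)) -> adding (lact b loop0) [:: i].
Proof.
have [c <-] := res_surj i => bA red [[av mc mr] gr].
set r := lact b loop0; have rL : loop r by apply: lact_loop.
apply/(adding1P rL (erefl _)); apply: contrapT => nadd.
have l0 : forall d, loop0 d <= r d by move=> d; apply: adding_le.
have s1 := loop_step c rL; have s2 := loop_stepP c rL.
have t1 := loop_step c loop0_loop; have t2 := loop_stepP c loop0_loop.
have l1 := l0 c; have l2 := l0 (c + 1); have l3 := l0 (c - 1).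
have [lt|e0] : loop0 c < r c \/ r c = loop0 c by lia.
  have [e1|e1] : r (c - 1) = r c \/ r (c - 1) = r c + 1 by lia.
    have [e2|e2] : r (c + 1) = r c \/ r (c + 1) = r c - 1 by lia.
      exact: (flat_horizontal bA red av lt e1 e2).
    have cr : corner r c by [].
    have ge := corner_ge loop0_loop rL l0 lt cr.
    have [b2 b2A b2E] := adding_exists loop0_loop (lact1_loop (res n c) rL) ge.
    have b2A' : adding loop0 (res n c :: b2).
      by apply/adding_cons => //; rewrite b2E; split=> //; apply: corner_adding.
    have b2E' : lact (res n c :: b2) loop0 = r by rewrite /= b2E lact1_involutive.
    apply: (@reduced_shorter (res n c) b b2) => //.
      by move: bA b2A'; rewrite /adding b2E' -/r /=; lia.
    by apply: (adding_cox_eq loop0_loop).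
  have e2 : r (c + 1) = r c - 1 by lia.
  exact: (flat_vertical bA red av lt e1 e2).
have [[e1 e2]|ne] : (r (c - 1) = loop0 (c - 1) /\ r (c + 1) = loop0 (c + 1)) \/
    ~ (r (c - 1) = loop0 (c - 1) /\ r (c + 1) = loop0 (c + 1)) by lia.
  have loop0A : adding loop0 [::] by rewrite /adding /= addr0.
  have [ce _] := adding_commute loop0_loop bA loop0A (erefl _) bA (erefl _) (esym e1) (esym e2).
  (* The letter moves to the right end of the word, where the Grassmannian condition applies. But r
     agrees with [loop0] around c, and [loop0] is addable at the contents of residue 0. *)
  have c0 : res n c = 0.
    apply: (gr b); rewrite -cats1; apply: reduced_cox_eq => //.
    by rewrite size_cat addn1.
  have /eqP : res n c = res n 0 by rewrite c0.
  move=> /(res_eqP _ _ n_gt1) [k]; rewrite add0r => ck.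
  apply: nadd; rewrite e1 e0 e2; have [a1 [a2 a3]] := loop0_addable.
  rewrite (_ : c - 1 = -1 + k * n%:Z); last by lia.
  rewrite (_ : c + 1 = 1 + k * n%:Z); last by lia.
  rewrite (_ : c = 0 + k * n%:Z); last by lia.
  by rewrite !(loopM _ _ loop0_loop) a1 a2 a3; lia.
(* If a neighbour of c has a new box while c has none and is not addable, the two steps of [loop0]
   at c are forced. *)
have cr : corner loop0 c by rewrite /corner; lia.
have [k ck] := corner_loop0 cr; set c0 := n%:Z - m%:Z in ck.
have rc : res n c = res n c0 by apply/eqP/res_eqP => //; exists k.
rewrite rc in red mc mr.
have v0 : loop0 c0 = 0 by rewrite loop0_small; lia.
have vp : loop0 (c0 + 1) = -1 by rewrite loop0_small; lia.
have vm : loop0 (c0 - 1) = 0 by rewrite loop0_small; lia.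
have E d x : d = x + k * n%:Z -> r d = r x - k * m%:Z /\ loop0 d = loop0 x - k * m%:Z.
  by move=> ->; rewrite !loopM.
have [E1 F1] := E _ _ ck.
have [E2 F2] := E (c + 1) (c0 + 1) ltac:(lia).
have [E3 F3] := E (c - 1) (c0 - 1) ltac:(lia).
have [h|h] : r (c + 1) = r c \/ r (c + 1) = r c - 1 by lia.
  have x1 : r c0 = 0 by lia.
  have x2 : r (c0 - 1) = 0 by lia.
  have x3 : r (c0 + 1) = 0 by lia.
  by have := boundary_maxc bA red x1 x2 x3; rewrite ltnNge mc.
have x1 : r c0 = 0 by lia.
have x2 : r (c0 - 1) = 1 by lia.
have x3 : r (c0 + 1) = -1 by lia.
by have := boundary_maxr bA red x1 x2 x3; rewrite ltnNge mr.
Qed.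

Lemma reduced_behead i b : reduced (i :: b) -> reduced b /\
  ell (sgen i * word_prod b)%g = (ell (word_prod b)).+1.
Proof.
rewrite /reduced word_prod_cons => e; have := ell_mul_le (sgen i) (word_prod b).
have : (ell (sgen i) <= 1)%N.
  by have := ell_word_le [:: i]; rewrite word_prod_cons /word_prod big_nil mulg1.
by have := ell_word_le b; rewrite /= in e; lia.
Qed.

Lemma A0_adding a : reduced a -> A0set m (word_prod a) -> adding loop0 a.
Proof.
elim: a => [|i b IH] red Aw; first by rewrite /adding /= addr0.
have [rb eb] := reduced_behead red.
have bA : adding loop0 b by apply: IH => //; apply: A0_suffix eb; rewrite -word_prod_cons.
by apply/adding_cons => //; split=> //; apply: A0_addable.
Qed.

Lemma A0_good (w : affS n) : A0set m w <-> good w.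
Proof.
split=> [Aw|]; last exact: good_A0.
have [a [aw sa]] := reduced_exists w.
have : adding loop0 a by apply: A0_adding; rewrite /reduced aw.
by move/adding_good => []; rewrite aw.
Qed.

(** * Chains of horizontal strips *)

Lemma loop_qanti r : loop r -> qanti n m r.
Proof. by move=> [rP rS]; split=> // c; case/andP: (rS c). Qed.

Lemma loop_conjP r (i : int) c : loop r -> (c <= conjf r i) = (i <= r c).
Proof. by move=> /loop_qanti; apply: conjfP. Qed.

Lemma loop_conjK r : loop r -> conjf (conjf r) = r.
Proof. by move=> /loop_qanti; apply: conjfK. Qed.

Lemma conj_per r : loop r -> qper m n (conjf r).
Proof. by move=> /loop_qanti /(conjf_qanti n_gt0 m_gt0) []. Qed.

Lemma conj_top r (i : int) : loop r -> i <= r (conjf r i).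
Proof. by move=> rL; rewrite -loop_conjP. Qed.

Lemma conj_strict r (i : int) : loop r -> conjf r (i + 1) < conjf r i.
Proof.
move=> rL.
have := conj_top (i + 1) rL; have := loop_step (conjf r (i + 1)) rL.
by have := loop_conjP i (conjf r (i + 1) + 1) rL; lia.
Qed.

(** The values of f stand for row lengths minus the row index, so strict decrease is the partition
    condition; on the conjugate it bounds the steps by 1. *)
Lemma strict_loop (f : int -> int) : qper m n f -> (forall i : int, f (i + 1) < f i) ->
  loop (conjf f) /\ conjf (conjf f) = f.
Proof.
move=> fP fS; have fQ : qanti m n f by split=> // i; apply: ltW.
have [cQ cA] := conjf_qanti m_gt0 n_gt0 fQ.
split; last exact: (conjfK m_gt0 n_gt0 fQ).
split=> // c; rewrite cA /=.
have h1 := conjfP (c + 1) (conjf f c - 1) m_gt0 n_gt0 fQ.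
have h2 : c <= f (conjf f c) by rewrite -(conjfP _ _ m_gt0 n_gt0 fQ).
by have := fS (conjf f c - 1); rewrite subrK; lia.
Qed.

Lemma conj_le r r' : loop r -> loop r' ->
  (forall c, r c <= r' c) <-> (forall i : int, conjf r i <= conjf r' i).
Proof.
move=> rL rL'; split=> le x.
  by rewrite loop_conjP //; apply: le_trans (conj_top _ rL) (le _).
by rewrite -loop_conjP //; apply: le_trans (le _); rewrite loop_conjP.
Qed.

(** This is the usual interlacing of row lengths; the strict inequality comes from the subtracted
    row index. *)
Lemma hstrip_conj r r' : loop r -> loop r' ->
  hstrip r r' <-> forall i : int, conjf r i <= conjf r' i < conjf r (i - 1).
Proof.
move=> rL rL'; split=> hs.
  have le : forall c, r c <= r' c by move=> c; case/andP: (hs c).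
  move=> i; rewrite (proj1 (conj_le rL rL') le) /=.
  have h := loop_conjP (i - 1) (conjf r' i + 1) rL.
  by have := hs (conjf r' i); have := conj_top i rL'; lia.
have le : forall i : int, conjf r i <= conjf r' i by move=> i; case/andP: (hs i).
move=> c; rewrite (proj2 (conj_le rL rL') le) /=.
have h1 := loop_conjP (r' c - 1) (c + 1) rL.
have h2 : c <= conjf r' (r' c) by rewrite loop_conjP.
by have := hs (r' c); lia.
Qed.

(** The rows congruent to r(c) + 1 modulo m become longer by one box, and there is one of them in a
    period. *)
Lemma conj_sum1 r i : loop r -> adding r [:: i] ->
  psum m (conjf (lact1 i r)) = psum m (conjf r) + 1.
Proof.
move=> rL iA; have aL := lact1_loop i rL; have [c ci] := res_surj i.
have [h1 h2] := proj1 (adding1P rL ci) iA.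
have aE := adding1E _ rL iA.
transitivity (psum m (conjf r) + \sum_(x < m) (m%:Z %| x%:Z - (r c + 1))%Z%:Z); last first.
  by rewrite psum_dvd.
rewrite /psum -big_split /=; apply: eq_bigr => x _.
apply: eq_cut => d; rewrite (loop_conjP _ _ aL) aE.
case: dvdzP => [[k kE]|ndvd]; last first.
  rewrite addr0 (loop_conjP _ _ rL) -ci; have [|] := boolP (res n d == res n c); last by lia.
  move=> /(res_eqP _ _ n_gt1) [k dE]; rewrite dE (loopM _ _ rL).
  by have : x%:Z - (r c + 1) <> (- k) * m%:Z by [move=> h; apply: ndvd; exists (- k)]; lia.
(* The translate of c whose new box lies in row x. *)
pose c' := c - k * n%:Z.
have sh y : r (y - k * n%:Z) = r y + k * m%:Z.
  by rewrite -mulNr (loopM _ _ rL); lia.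
have rc' : r c' = x%:Z - 1 by rewrite /c' sh; lia.
have rm : r (c' - 1) = x%:Z by rewrite /c' addrAC sh h1; lia.
have rp : r (c' + 1) = x%:Z - 1 by rewrite /c' addrAC sh h2; lia.
have c'i : res n c' = i.
  by rewrite -ci; apply/eqP/res_eqP => //; exists (- k); rewrite /c'; lia.
have -> : (d <= conjf r x%:Z + true%:Z) = (x%:Z <= r (d - 1)).
  by rewrite -(loop_conjP _ _ rL) /=; lia.
rewrite -aE.
have [dc|dc] : d <= c' \/ c' + 1 <= d by lia.
  have := @loop_le r (d - 1) (c' - 1) rL ltac:(lia).
  have := @loop_le (lact1 i r) d c' aL dc; rewrite [lact1 i r c']aE c'i eqxx; lia.
have := @loop_le r c' (d - 1) rL ltac:(lia).
have := @loop_le (lact1 i r) (c' + 1) d aL dc.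
by rewrite [lact1 i r (c' + 1)]aE -c'i resS_neq; lia.
Qed.

Lemma conj_sum r r' : loop r -> loop r' -> (forall c, r c <= r' c) ->
  psum m (conjf r') - psum m (conjf r) = lsum r' - lsum r.
Proof.
move=> rL rL' le; have [a aA <-] := adding_exists rL rL' le.
elim: a aA => [|i a IH]; first by rewrite /= !subrr.
move=> /(adding_cons _ _ rL) [/IH aE iA] /=.
by rewrite (conj_sum1 (lact_loop a rL) iA); move: iA; rewrite /adding /=; lia.
Qed.

Lemma hstrip_le r r' : hstrip r r' -> forall c, r c <= r' c.
Proof. by move=> hs c; case/andP: (hs c). Qed.

(* Bender-Knuth: given [hstrip r s] and [hstrip s t], the rows of [s] vary
   independently in intervals, in each of which [s] is reflected. *)
Definition bk_lo r t (i : int) := Num.max (conjf r i) (conjf t (i + 1) + 1).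
Definition bk_hi r t (i : int) := Num.min (conjf t i) (conjf r (i - 1) - 1).
Definition bk_row r s t (i : int) := bk_lo r t i + bk_hi r t i - conjf s i.
Definition bk r s t := conjf (bk_row r s t).

Lemma bkP r s t : loop r -> loop s -> loop t -> hstrip r s -> hstrip s t ->
  [/\ loop (bk r s t), hstrip r (bk r s t), hstrip (bk r s t) t,
      bk r (bk r s t) t = s & lsum (bk r s t) = lsum r + lsum t - lsum s].
Proof.
move=> rL sL tL rs st.
have RS := proj1 (hstrip_conj rL sL) rs; have ST := proj1 (hstrip_conj sL tL) st.
have B (i : int) : bk_lo r t i <= conjf s i <= bk_hi r t i.
  have := ST (i + 1); rewrite addrK; have := RS i; have := ST i.
  by rewrite /bk_lo /bk_hi; lia.
have rP := conj_per rL; have sP := conj_per sL; have tP := conj_per tL.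
have fP : qper m n (bk_row r s t).
  move=> i; rewrite /bk_row /bk_lo /bk_hi.
  have -> : i + m%:Z + 1 = i + 1 + m%:Z by lia.
  have -> : i + m%:Z - 1 = i - 1 + m%:Z by lia.
  by rewrite !(rP, sP, tP); lia.
have fB (i : int) : bk_lo r t i <= bk_row r s t i <= bk_hi r t i.
  by have := B i; rewrite /bk_row; lia.
(* The interval of row i + 1 ends at most at [conjf r i - 1], below the start of the interval of row
   i, so any choice of values in the intervals is strictly decreasing. *)
have fS (i : int) : bk_row r s t (i + 1) < bk_row r s t i.
  have := fB i; have := fB (i + 1); rewrite {1}/bk_hi [bk_lo r t i]/bk_lo addrK; lia.
have [bL bK] := strict_loop fP fS.
have le1 : hstrip r (bk r s t).
  apply/hstrip_conj => // i; rewrite bK; have := fB i; rewrite /bk_lo /bk_hi; lia.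
have le2 : hstrip (bk r s t) t.
  apply/hstrip_conj => // i; rewrite bK; have := fB i; have := fB (i - 1).
  by rewrite /bk_lo /bk_hi subrK; lia.
split=> //.
  rewrite -[RHS](loop_conjK sL) /bk; congr conjf; apply/funext => i.
  by rewrite {1}/bk_row bK /bk_row; lia.
have := conj_sum rL bL (hstrip_le le1); have := conj_sum rL sL (hstrip_le rs).
have := conj_sum sL tL (hstrip_le st); rewrite -/(bk r s t) bK.
suff : psum m (bk_row r s t) = psum m (conjf r) + psum m (conjf t) - psum m (conjf s) by lia.
have hP : qper m n (bk_hi r t).
  move=> i; rewrite /bk_hi; have -> : i + m%:Z - 1 = i - 1 + m%:Z by lia.
  by rewrite !(rP, tP); lia.
have e1 : psum m (bk_row r s t) = psum m (bk_lo r t) + psum m (bk_hi r t) - psum m (conjf s).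
  by rewrite /psum -big_split -sumrB.
(* Since max(a, b + 1) + min(b, a - 1) = a + b, the lower end of a row pairs with the upper end of
   the next. The shifts by one row on both sides cost the same n. *)
have e2 : psum m (bk_lo r t) + psum m (fun i : int => bk_hi r t (i + 1)) =
    psum m (conjf r) + psum m (fun i : int => conjf t (i + 1)).
  rewrite /psum -!big_split /=; apply: eq_bigr => i _.
  by rewrite /bk_lo /bk_hi addrK; lia.
by have := psum_shift hP; have := psum_shift tP; lia.
Qed.

(* The head of [s] is the shape left after removing the outermost strip of r. *)
Fixpoint chain r (al : seq nat) (s : seq (int -> int)) : Prop :=
  match al, s with
  | [::], [::] => r = loop0
  | k :: al', q :: s' =>
      [/\ loop q, hstrip q r, lsum r = lsum q + k%:Z & chain q al' s']
  | _, _ => False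
  end.

Definition chains r al := [set s | chain r al s]%classic.

Lemma chains_cons r (k : nat) al al' :
  (forall q, loop q -> equipotent (chains q al) (chains q al')) ->
  equipotent (chains r (k :: al)) (chains r (k :: al')).
Proof.
move=> e.
have /choice [F FP] : forall q, exists F : (seq (int -> int) -> seq (int -> int)) *
    (seq (int -> int) -> seq (int -> int)), loop q ->
    (forall x, chains q al x -> chains q al' (F.1 x) /\ F.2 (F.1 x) = x) /\
    (forall y, chains q al' y -> chains q al (F.2 y) /\ F.1 (F.2 y) = y).
  move=> q; have [qL|nq] := pselect (loop q); last by exists (id, id).
  by have [f [g fg]] := e q qL; exists (f, g).
exists (fun s => if s is q :: s' then q :: (F q).1 s' else [::]).
exists (fun s => if s is q :: s' then q :: (F q).2 s' else [::]).
split=> -[|q s] //= [qL hs le] c; have [h1 h2] := FP q qL.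
  by have [c' ->] := h1 _ c.
by have [c' ->] := h2 _ c.
Qed.

(** Only the shape between the two outermost strips changes: [bk] complements its number of boxes,
    which exchanges the two weights. *)
Lemma chains_swap r (k l : nat) al : loop r ->
  equipotent (chains r (k :: l :: al)) (chains r (l :: k :: al)).
Proof.
move=> rL.
pose f s := if s is q :: p :: s' then bk p q r :: p :: s' else s.
have fC (k' l' : nat) s :
    chain r (k' :: l' :: al) s -> chain r (l' :: k' :: al) (f s) /\ f (f s) = s.
  case: s => [|q [|p s]] //=; first by case.
  move=> [qL qr e1 [pL pq e2 c]].
  have [bL h1 h2 h3 h4] := bkP pL qL rL pq qr.
  by split; [do 2?split=> //; lia|rewrite h3].
by exists f, f; split=> s /fC.
Qed.

Lemma chains_rcons r (k : nat) al : loop r ->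
  equipotent (chains r (k :: al)) (chains r (rcons al k)).
Proof.
elim: al r => [|l al IH] r rL; first exact: equipotent_refl.
by apply: equipotent_trans (chains_swap _ _ _ rL) _; apply: chains_cons.
Qed.

Lemma chains_rev r al : loop r -> equipotent (chains r al) (chains r (rev al)).
Proof.
elim: al r => [|k al IH] r rL; first exact: equipotent_refl.
rewrite rev_cons; apply: equipotent_trans (chains_rcons _ _ rL).
exact: chains_cons.
Qed.

(** * Factorizations into cyclically decreasing elements as chains *)

Lemma cyc_hstrip (w x v : affS n) : good w -> w = (x * v)%g -> cyc_decreasing x ->
  ell w = (ell x + ell v)%N ->
  [/\ good v, hstrip (wact v loop0) (wact w loop0)
    & lsum (wact w loop0) = lsum (wact v loop0) + (ell x)%:Z].
Proof.
move=> gw wE [J _ [a [ua aJ ord xE]]] le.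
have gv : good v by apply: (@good_suffix x); rewrite -wE.
have xa : ell x = size a by rewrite xE ell_uniq.
have [b [bE sb]] := reduced_exists v.
have : reduced_word w (a ++ b).
  by split; [rewrite word_prod_cat bE -xE|rewrite size_cat sb le xa].
move=> /(good_adding gw) /(adding_cat _ _ loop0_loop) [bA aA].
have -> : wact w loop0 = lact a (lact b loop0) by rewrite wE xE wactM wact_word -bE wact_word.
have -> : wact v loop0 = lact b loop0 by rewrite -bE wact_word.
split=> //; last by rewrite aA xa.
apply: decreasing_hstrip => //; first exact: lact_loop.
by move=> j ja ja1; apply: ord; rewrite -aJ.
Qed.

Lemma hstrip_cyc (w v : affS n) : good w -> good v ->
  hstrip (wact v loop0) (wact w loop0) ->
  cyc_decreasing (w * v^-1)%g /\ ell w = (ell (w * v^-1)%g + ell v)%N.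
Proof.
move=> gw gv hs; set r := wact v loop0 in hs; set r' := wact w loop0 in hs.
have rL : loop r by apply: wact_loop.
have rL' : loop r' by apply: wact_loop.
have [a aA aE] := adding_exists rL rL' (hstrip_le hs).
have [b [bE sb]] := reduced_exists v.
have bA : adding loop0 b by apply: (good_adding gv).
have br : lact b loop0 = r by rewrite /r -bE wact_word.
have abA : adding loop0 (a ++ b) by apply/adding_cat => //; rewrite br.
have [gab lab] := adding_good abA.
have we : word_prod (a ++ b) = w.
  by apply: good_inj => //; rewrite wact_word lact_cat br aE.
have xE : (w * v^-1)%g = word_prod a by rewrite -we word_prod_cat bE mulgK.
rewrite -aE in hs; have [ua ord] := hstrip_word rL aA hs.
have xl : ell (w * v^-1)%g = size a by rewrite xE ell_uniq.
split; last by rewrite xl -sb -we lab size_cat.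
have aJ : a =i [set x in a] by move=> x; rewrite finset.in_set.
exists [set x in a]; last by exists a; split=> // j; rewrite -!aJ; apply: ord.
(* Where r drops, a horizontal strip has no box of that content, so one residue is missing from the
   set. *)
rewrite finset.properT; have [c cE] := loop_vstep rL.
apply/negP => /eqP aT; have : res n c \in a by rewrite aJ aT finset.in_setT.
by move=> ca; have := hs c; rewrite (adding_uniqE c rL aA ua) ca; lia.
Qed.

Fixpoint facts (w : affS n) (al : seq nat) (s : seq (affS n)) : Prop :=
  match al, s with
  | [::], [::] => w = 1%g
  | k :: al', x :: s' =>
      [/\ cyc_decreasing x, ell x = k, ell w = (k + ell (x^-1 * w)%g)%N
        & facts (x^-1 * w)%g al' s']
  | _, _ => False
  end.

Fixpoint tochain (w : affS n) (s : seq (affS n)) : seq (int -> int) :=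
  if s is x :: s' then wact (x^-1 * w)%g loop0 :: tochain (x^-1 * w)%g s' else [::].

Definition good_of (q : int -> int) : affS n :=
  xget 1%g [set v | good v /\ wact v loop0 = q]%classic.

Fixpoint ofchain (w : affS n) (s : seq (int -> int)) : seq (affS n) :=
  if s is q :: s' then (w * (good_of q)^-1)%g :: ofchain (good_of q) s' else [::].

Lemma good_ofP q : loop q -> (forall c, loop0 c <= q c) ->
  good (good_of q) /\ wact (good_of q) loop0 = q.
Proof.
move=> qL ge; have [v gv vE] := good_exists qL ge.
by apply: (@xgetPex _ 1%g [set v | good v /\ wact v loop0 = q]%classic); exists v.
Qed.

Lemma good_ofK v : good v -> good_of (wact v loop0) = v.
Proof.
move=> gv; have [||g e] := @good_ofP (wact v loop0).
- exact: wact_loop.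
- by move=> c; apply: good_ge.
exact: good_inj.
Qed.

Lemma chain_ge r al s c : chain r al s -> loop0 c <= r c.
Proof.
elim: al r s => [|k al IH] r [|q s] //=; first by move=> ->.
by move=> [_ hs _ /IH le]; have := hs c; lia.
Qed.

Lemma facts_chain w al s : good w -> facts w al s ->
  chain (wact w loop0) al (tochain w s) /\ ofchain w (tochain w s) = s.
Proof.
elim: al w s => [|k al IH] w [|x s] gw //=; first by move=> ->; rewrite wact1.
move=> [cx ex ew fs]; set v := (x^-1 * w)%g in ew fs *.
have wE : w = (x * v)%g by rewrite mulKVg.
have [gv hs le] := cyc_hstrip gw wE cx ltac:(lia).
have [c e] := IH _ _ gv fs; rewrite good_ofK // e; split.
  by split=> //; [exact: wact_loop|rewrite le ex].
by congr cons; rewrite wE mulgK.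
Qed.

Lemma chain_facts w al s : good w -> chain (wact w loop0) al s ->
  facts w al (ofchain w s) /\ tochain w (ofchain w s) = s.
Proof.
elim: al w s => [|k al IH] w [|q s] gw //=.
  by move=> e; split=> //; apply: ell_eq0; move: gw; rewrite /good e; lia.
move=> [qL hs le cs].
have [gv vE] := good_ofP qL (fun c => chain_ge c cs); set v := good_of q in gv vE *.
rewrite -vE in hs le cs.
have [cx lw] := hstrip_cyc gw gv hs.
have -> : ((w * v^-1)^-1 * w)%g = v by rewrite invMg invgK mulgKV.
have [f e] := IH _ _ gv cs; rewrite vE e; split=> //; split=> //.
  by move: gw gv; rewrite /good; lia.
by move: gw gv; rewrite /good; lia.
Qed.

Lemma facts_equipotent w al : good w ->
  equipotent [set s | facts w al s]%classic (chains (wact w loop0) al).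
Proof.
move=> gw; exists (tochain w), (ofchain w).
by split=> s; [apply: facts_chain|apply: chain_facts].
Qed.

Lemma ell_prod_le (s : seq (affS n)) :
  (ell (\prod_(x <- s) x)%g <= sumn (map (@ell n) s))%N.
Proof.
elim: s => [|x s IH]; first by rewrite big_nil ell1.
rewrite big_cons /=; apply: leq_trans (ell_mul_le _ _) _.
by rewrite leq_add2l.
Qed.

(** Peeling factors one by one requires additive lengths at each stage. By subadditivity of [ell]
    this already follows from the single equality for the total. *)
Lemma factsP w al s : facts w al s <->
  [/\ forall x, x \in s -> cyc_decreasing x, map (@ell n) s = al,
      (\prod_(x <- s) x)%g = w & sumn al = ell w].
Proof.
split.
  elim: al w s => [|k al IH] w [|x s] //=.
    by move=> ->; rewrite big_nil ell1.
  move=> [cx ex ew /IH [cs es ps le]]; split.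
  - by move=> y; rewrite inE => /orP [/eqP ->|/cs].
  - by rewrite ex es.
  - by rewrite big_cons ps mulKVg.
  - by rewrite le ew.
elim: al w s => [|k al IH] w [|x s] [cs es ps le] //=.
  by rewrite -ps big_nil.
case: es => ex es; move: ps; rewrite big_cons => ps.
have vE : (x^-1 * w)%g = (\prod_(y <- s) y)%g by rewrite -ps mulKg.
have lv : sumn al = ell (x^-1 * w)%g.
  have := ell_prod_le s; have := ell_mul_le x (x^-1 * w)%g.
  by rewrite es mulKVg -vE ex; move: le => /=; lia.
split=> //; first by apply: cs; rewrite mem_head.
  by rewrite -le -lv.
by apply: IH; split=> // y ys; apply: cs; rewrite inE ys orbT.
Qed.

Lemma prod_nat_eq1 (f : nat -> affS n) (K L : nat) : (forall i : nat, (K <= i)%N -> f i = 1%g) ->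
  (K <= L)%N -> (\prod_(0 <= i < L) f i = \prod_(0 <= i < K) f i)%g.
Proof.
move=> f1 KL; rewrite (@big_cat_nat _ _ _ K) //= [X in (_ * X)%g]big_nat_cond.
by rewrite [X in (_ * X)%g]big1 ?mulg1 // => i; rewrite andbT => /andP [Ki _]; apply: f1.
Qed.

Lemma factors_prodE (f : affS_fact n) N : (forall i : nat, (N <= i)%N -> f i = 1%g) ->
  factors_prod f = (\prod_(x <- mkseq f N) x)%g.
Proof.
move=> fN; rewrite big_map /factors_prod.
set M := (\max_(j <- finsupp f) j).+1.
have fM (i : nat) : (M <= i)%N -> f i = 1%g.
  move=> Mi; apply: fsfun_dflt; apply/negP => fi.
  by have := @leq_bigmax_seq _ _ xpredT id _ fi isT; rewrite -ltnS -/M ltnNge Mi.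
rewrite -(prod_nat_eq1 fM (leq_maxl M N)) (prod_nat_eq1 fN (leq_maxr M N)).
by rewrite /index_iota subn0.
Qed.

Lemma finsupp_sum (g : nat -> nat) (S : seq nat) (N : nat) : uniq S ->
  (forall i : nat, i \in S -> (i < N)%N) -> (forall i : nat, i \notin S -> g i = 0%N) ->
  (\sum_(i <- S) g i = \sum_(0 <= i < N) g i)%N.
Proof.
move=> uS SN g0; rewrite [RHS](bigID (fun i : nat => i \in S)) /= [X in (_ + X)%N]big1 ?addn0.
  rewrite -[RHS]big_filter; apply: perm_big; apply: uniq_perm => //.
    by rewrite filter_uniq // iota_uniq.
  move=> i; rewrite mem_filter mem_index_iota /=.
  by case: (boolP (i \in S)) => //= /SN ->.
by move=> i /g0.
Qed.

(** From N on the factors have length 0, hence equal 1, so a finitely supported factorization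
    amounts to its first N terms. *)
Lemma is_fact_equipotent (w : affS n) (al : nat -> nat) N :
  (forall i : nat, (N <= i)%N -> al i = 0%N) ->
  equipotent [set f | is_fact w f /\ forall i : nat, ell (f i) = al i]%classic
    [set s | facts w (mkseq al N) s]%classic.
Proof.
move=> aN.
pose g (s : seq (affS n)) : affS_fact n :=
  [fsfun i in seq_fset tt (iota 0 N) => nth 1%g s i].
have gE s (i : nat) : g s i = if (i < N)%N then nth 1%g s i else 1%g.
  by rewrite fsfunE seq_fsetE mem_iota /= add0n.
exists (fun f => mkseq f N), g; split=> [f [[cf pf sf] ef]|s /factsP [cs es ps ss]].
  have fN (i : nat) : (N <= i)%N -> f i = 1%g by move=> Ni; apply: ell_eq0; rewrite ef aN.
  split.
    apply/factsP; split.
    - by move=> x /mapP [i _ ->].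
    - by rewrite /mkseq -map_comp; apply: eq_map.
    - by rewrite -pf -factors_prodE.
    - rewrite -sf sumnE big_map [RHS](@finsupp_sum _ _ N) //.
      + by rewrite /index_iota subn0; apply: eq_bigr => i _; rewrite ef.
      + exact: fset_uniq.
      + by move=> i; rewrite mem_finsupp; apply: contraNltn => /fN ->.
      + by move=> i; rewrite mem_finsupp negbK => /eqP ->; rewrite ell1.
  apply/fsfunP => i; rewrite gE; case: ltnP => iN; first by rewrite nth_mkseq.
  by rewrite fN.
have sN : size s = N by have := congr1 size es; rewrite size_map size_mkseq.
have gs : mkseq (g s) N = s.
  by apply: (@eq_from_nth _ 1%g); rewrite size_mkseq // => i iN; rewrite nth_mkseq // gE iN.
have gN (i : nat) : (N <= i)%N -> g s i = 1%g by move=> Ni; rewrite gE ltnNge Ni.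
have ge (i : nat) : ell (g s i) = al i.
  rewrite gE; case: ltnP => iN; last by rewrite ell1 aN.
  by rewrite -(nth_mkseq 0%N al iN) -es (nth_map 1%g) // sN.
split=> //; split=> //; split.
- move=> i; rewrite gE; case: ltnP => iN; first by apply: cs; rewrite mem_nth ?sN.
  exists finset.set0; last first.
    exists [::]; split=> // [j|j|]; rewrite ?finset.in_set0 //.
    by rewrite /word_prod big_nil.
  by rewrite properEcard finset.sub0set cards0 cardsT card_ord.
- by rewrite (factors_prodE gN) gs.
- rewrite -ss sumnE big_map (@finsupp_sum _ (finsupp (g s)) N) //.
  + by rewrite /index_iota subn0; apply: eq_bigr => i _; rewrite ge.
  + exact: fset_uniq.
  + by move=> i; rewrite mem_finsupp; apply: contraNltn => /gN ->.
  + by move=> i; rewrite mem_finsupp negbK => /eqP ->; rewrite ell1.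
Qed.

(** * Tableaux *)

Lemma natB_int : (n - m)%N%:Z = n%:Z - m%:Z. Proof. lia. Qed.

(* The class of the box in row i with content c. *)
Definition cell (c i : int) : set (int * int) := cyl_class m n (i, i + c).

Lemma cyl_classE (i j : int) : cyl_class m n (i, j) = cell (j - i) i.
Proof. by rewrite /cell addrC subrK. Qed.

Lemma cellP (c i c' i' : int) : cell c i = cell c' i' <->
  exists k : int, c' = c - k * n%:Z /\ i' = i + k * m%:Z.
Proof.
split=> [e|[k [-> ->]]].
  have : cell c' i' (i', i' + c') by exists 0; rewrite !mul0r addr0 subr0.
  rewrite -e => -[k /= [e1 e2]]; exists k; rewrite natB_int in e2; split=> //; lia.
apply/seteqP; split=> x [l /= ->].
  by exists (l - k) => /=; rewrite natB_int; congr pair; lia.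
by exists (l + k) => /=; rewrite natB_int; congr pair; lia.
Qed.

Lemma cell_per (c i k : int) : cell (c + k * n%:Z) i = cell c (i + k * m%:Z).
Proof. by apply/cellP; exists k; split; lia. Qed.

Lemma cell_surj x : (exists p, x = cyl_class m n p) ->
  exists (c : 'I_n) (i : int), x = cell c%:Z i.
Proof.
move=> [[i j] ->]; rewrite cyl_classE; have [e [k ->]] := int_divE (j - i) n_gt0.
by exists e, (i + k * m%:Z); rewrite cell_per.
Qed.

Definition diag r : set (set (int * int)) :=
  [set cyl_class m n p | p in [set p : int * int |
     loop0 (p.2 - p.1) < p.1 /\ p.1 <= r (p.2 - p.1)]]%classic.

Definition inside r (c i : int) := loop0 c < i <= r c.

Lemma diag_cell r (c i : int) : loop r -> diag r (cell c i) <-> inside r c i.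
Proof.
move=> rL; rewrite /inside; split=> [[[i' j'] /= [h1 h2]]|/andP [h1 h2]].
  rewrite cyl_classE => /cellP [k [-> ->]]; rewrite -mulNr !loopM //; lia.
by exists (i, i + c) => //=; rewrite (_ : i + c - i = c); lia.
Qed.

Lemma diag_cellP r x : loop r -> diag r x ->
  exists (c : 'I_n) (i : int), x = cell c%:Z i /\ inside r c%:Z i.
Proof.
move=> rL dx; have [|c [i xE]] := @cell_surj x; first by case: dx => p _ <-; exists p.
by exists c, i; split=> //; apply/diag_cell => //; rewrite -xE.
Qed.

Definition tab r (T : cyl_filling) :=
  [/\ forall x, diag r x <-> (0 < T x)%N,
      forall c i : int, inside r c i -> inside r (c + 1) i ->
        (T (cell c i) <= T (cell (c + 1) i))%N
    & forall c i : int, inside r c i -> inside r (c - 1) (i + 1) ->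
        (T (cell c i) < T (cell (c - 1) (i + 1)))%N].

Lemma sum_bool_count (I : Type) (b : pred I) (s : seq I) :
  \sum_(x <- s) (b x)%:Z = (count b s)%:Z :> int.
Proof. by elim: s => [|x s IH]; rewrite ?big_nil // big_cons IH /=; lia. Qed.

(** * From a tableau to its chain of shapes *)

Section OneTableau.
Variables (r : int -> int) (T : cyl_filling).
Hypotheses (rL : loop r) (tT : tab r T) (r_ge : forall c, loop0 c <= r c).

(** The boxes with entry at most k, together with all of the empty shape, form the shape with loop
    [levels k]. *)
Definition below (k : nat) (c i : int) :=
  i <= loop0 c \/ (inside r c i /\ (T (cell c i) <= k)%N).

Definition levels (k : nat) (c : int) : int := topof (below k c).

(** Two consecutive boxes of a diagonal are joined by a step down, where the entry increases
    strictly, and a step to the right, where it increases weakly. *)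
Lemma below_down (k : nat) (c i : int) : below k c i -> below k c (i - 1).
Proof.
move=> [le|[ins Tk]]; first by left; lia.
have [le|lt] := boolP (i - 1 <= loop0 c); [by left|right].
case: tT => _ t1 t2.
have s1 := loop_stepP c loop0_loop; have s2 := loop_stepP c rL.
have i1 : inside r c (i - 1) by move: ins; rewrite /inside; lia.
have i2 : inside r (c - 1) (i - 1 + 1) by move: ins; rewrite /inside; lia.
split=> //; apply: leq_trans Tk; apply/ltnW.
apply: leq_trans (t2 _ _ i1 i2) _; rewrite subrK in i2 *.
by have := t1 _ _ i2; rewrite subrK; apply.
Qed.

Lemma levelsP (k : nat) (c i : int) : below k c i <-> i <= levels k c.
Proof.
move: i; apply: topofP; apply: (@cut_exists _ (loop0 c) (r c)); first by left.
  by move=> i [le|[/andP [_ le] _] //]; apply: le_trans (r_ge c).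
move=> i j ij; have [d ->] : exists d : nat, i = j - d%:Z by exists `|j - i|%N; lia.
elim: d => [|d IH]; first by rewrite subr0.
by move=> /IH /below_down; rewrite (_ : j - d.+1%:Z = j - d%:Z - 1) //; lia.
Qed.

Lemma levels_cut (k : nat) (c : int) (P : int -> Prop) (y : int) :
  (forall i : int, below k c i <-> P i) -> (forall i : int, P i <-> i <= y) -> levels k c = y.
Proof.
move=> h1 h2; apply: eq_cut => i; apply/idP/idP.
  by move=> /levelsP /h1 /h2.
by move=> /h2 /h1 /levelsP.
Qed.

Lemma levels_loop (k : nat) : loop (levels k).
Proof.
split=> c.
  apply: (@levels_cut k _ (fun i : int => below k c (i + m%:Z))) => i; last first.
    by rewrite levelsP; lia.
  have := (proj1 loop0_loop) c; have := (proj1 rL) c.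
  rewrite /below /inside (_ : c + n%:Z = c + 1 * n%:Z) ?cell_per ?mul1r; last by lia.
  by move=> -> ->; split=> -[h|[h1 h2]]; [left|right|left|right]; try split=> //; lia.
have s0 := loop_step c loop0_loop; have sr := loop_step c rL.
case: tT => _ t1 t2; apply/andP; split.
  apply/levelsP; have /levelsP [le|[ins Tk]] := lexx (levels k (c + 1)); first by left; lia.
  have [le|lt] := boolP (levels k (c + 1) <= loop0 c); [by left|right].
  have i1 : inside r c (levels k (c + 1)) by move: ins; rewrite /inside; lia.
  by split=> //; apply: leq_trans (t1 _ _ i1 ins) Tk.
suff : below k (c + 1) (levels k c - 1) by move/levelsP; lia.
have /levelsP [le|[ins Tk]] := lexx (levels k c); first by left; lia.
have [le|lt] := boolP (levels k c - 1 <= loop0 (c + 1)); [by left|right].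
have i1 : inside r (c + 1) (levels k c - 1) by move: ins; rewrite /inside; lia.
split=> //; apply: leq_trans Tk; apply/ltnW.
by have := t2 _ _ i1; rewrite addrK subrK; apply.
Qed.

(** By column strictness, the box above one with entry at most k + 1 has entry at most k or belongs
    to the empty shape. *)
Lemma levels_hstrip (k : nat) : hstrip (levels k) (levels k.+1).
Proof.
move=> c; case: tT => _ _ t2; apply/andP; split.
  apply/levelsP; have /levelsP [le|[ins Tk]] := lexx (levels k c); first by left.
  by right; split=> //; apply: leqW.
have s0 := loop_step c loop0_loop; have sr := loop_step c rL.
suff : below k (c + 1) (levels k.+1 c - 1) by move/levelsP; lia.
have /levelsP [le|[ins Tk]] := lexx (levels k.+1 c); first by left; lia.
have [le|lt] := boolP (levels k.+1 c - 1 <= loop0 (c + 1)); [by left|right].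
have i1 : inside r (c + 1) (levels k.+1 c - 1) by move: ins; rewrite /inside; lia.
split=> //; rewrite -ltnS; apply: leq_trans Tk.
by have := t2 _ _ i1; rewrite addrK subrK; apply.
Qed.

Lemma levels0 : levels 0 = loop0.
Proof.
apply/funext => c; apply: (@levels_cut 0 c (fun i : int => i <= loop0 c)) => // i.
split=> [[//|[ins]]|]; last by left.
by case: tT => /(_ (cell c i)) [/(_ (proj2 (diag_cell _ _ rL) ins))]; case: (T _).
Qed.

Lemma levels_top N : (forall x, (T x <= N)%N) -> levels N = r.
Proof.
move=> TN; apply/funext => c; apply: (@levels_cut N c (fun i : int => i <= r c)) => // i.
split=> [[le|[/andP [_ le] _] //]|le]; first exact: le_trans (r_ge c).
by have [l|l] := boolP (i <= loop0 c); [left|right; rewrite /inside; split=> //; lia].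
Qed.

(** A horizontal strip adds at most one box on each diagonal, so the classes of boxes with entry k +
    1 correspond to the contents in [0, n) at which the loop rises. *)
Lemma levels_sum (k : nat) :
  lsum (levels k.+1) = lsum (levels k) + (filling_exp T k.+1)%:Z.
Proof.
set u := levels k; set v := levels k.+1.
have uv (c : int) : v c = u c + (v c != u c)%:Z.
  have := levels_hstrip k c; have := loop_step c (levels_loop k).
  by rewrite -/u -/v; case: eqP; lia.
pose J := [seq c : 'I_n <- index_enum 'I_n | v c%:Z != u c%:Z].
have -> : lsum v = lsum u + (size J)%:Z.
  rewrite size_filter -sum_bool_count /psum -big_split /=.
  by apply: eq_bigr => c _; apply: uv.
congr (_ + _%:Z).
rewrite /filling_exp -size_filter -(size_map (fun c : 'I_n => cell c%:Z (v c%:Z))).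
apply: perm_size; apply: uniq_perm.
- rewrite map_inj_uniq ?filter_uniq ?index_enum_uniq // => c d /cellP [q [e1 _]].
  apply: val_inj => /=; have := ltn_ord c; have := ltn_ord d.
  have [q0|[q0|q0]] : (q < 0) \/ (q > 0) \/ (q = 0) by lia.
  + nia.
  + nia.
  by rewrite q0 in e1; lia.
- by rewrite filter_uniq // fset_uniq.
move=> x; rewrite mem_filter; apply/mapP/andP => [[c]|[/eqP Tx _]].
  rewrite mem_filter => /andP [vu _] xE.
  have lt : u c%:Z < v c%:Z by have := uv c%:Z; rewrite vu; lia.
  have /levelsP [le|[ins Tk]] := lexx (v c%:Z).
    have : below k c%:Z (v c%:Z) by left.
    by move/levelsP; rewrite -/u; lia.
  have Tx : T x = k.+1.
    apply/eqP; rewrite xE eqn_leq Tk /= ltnNge; apply/negP => Tk'.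
    have : below k c%:Z (v c%:Z) by right.
    by move/levelsP; rewrite -/u; lia.
  by rewrite Tx eqxx mem_finsupp Tx.
have : diag r x by case: tT => /(_ x) [_ h] _ _; apply: h; rewrite Tx.
move=> /(diag_cellP rL) [c [i [xE ins]]].
have lv : i <= v c%:Z by apply/levelsP; right; rewrite -xE Tx.
have gu : u c%:Z < i.
  rewrite ltNge; apply/negP => /levelsP [le|[_]]; first by move: ins; rewrite /inside; lia.
  by rewrite -xE Tx ltnn.
exists c; last by rewrite xE; congr cell; have := uv c%:Z; case: (_ != _); lia.
rewrite mem_filter mem_index_enum andbT; apply/eqP; lia.
Qed.

End OneTableau.

(** * From a chain of shapes to its tableau *)

Fixpoint gseq (G : nat -> int -> int) (N : nat) : seq (int -> int) :=
  if N is N'.+1 then G N' :: gseq G N' else [::].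

Lemma size_gseq G N : size (gseq G N) = N.
Proof. by elim: N => //= N ->. Qed.

Lemma nth_gseq G N (j : nat) (d : int -> int) :
  (j < N)%N -> nth d (gseq G N) j = G (N - j.+1)%N.
Proof.
elim: N j => // N IH [|j] jN /=; first by rewrite subSS subn0.
by rewrite IH // subSS.
Qed.

Lemma rev_mkseqS (al : nat -> nat) N : rev (mkseq al N.+1) = al N :: rev (mkseq al N).
Proof. by rewrite /mkseq -addn1 iotaD map_cat rev_cat /= add0n. Qed.

Lemma gseq_chain G (al : nat -> nat) N : G 0%N = loop0 -> (forall k : nat, loop (G k)) ->
  (forall k : nat, hstrip (G k) (G k.+1)) ->
  (forall k : nat, lsum (G k.+1) = lsum (G k) + (al k)%:Z) ->
  chain (G N) (rev (mkseq al N)) (gseq G N).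
Proof.
move=> G0 GL Gh Gs; elim: N => [|N IH]; first exact: G0.
by rewrite rev_mkseqS.
Qed.

Lemma chain_gseq_sum G (al : nat -> nat) N (k : nat) :
  chain (G N) (rev (mkseq al N)) (gseq G N) -> (k < N)%N ->
  lsum (G k.+1) = lsum (G k) + (al k)%:Z.
Proof.
elim: N => // N IH; rewrite rev_mkseqS /= => -[_ _ e c].
by rewrite ltnS leq_eqVlt => /orP [/eqP ->//|]; apply: IH.
Qed.

Lemma chain_size r al s : chain r al s -> size s = size al.
Proof. by elim: al r s => [|k al IH] r [|q s] //= [_ _ _ /IH ->]. Qed.

(* The entry of a box is the number of shapes of the chain not containing it. *)
Definition tval (s : seq (int -> int)) (c i : int) : nat := count (fun q => q c < i) s.

Lemma tval_per r al s (c i k : int) : chain r al s ->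
  tval s (c + k * n%:Z) i = tval s c (i + k * m%:Z).
Proof.
elim: al r s => [|a al IH] r [|q s] //= [qL _ _ /IH e].
by rewrite /tval /= -!/(tval _ _ _) e (loopM _ _ qL) ltrBlDr.
Qed.

Lemma tval_row r al s (c i : int) : chain r al s -> (tval s c i <= tval s (c + 1) i)%N.
Proof.
elim: al r s => [|a al IH] r [|q s] //= [qL _ _ /IH le].
rewrite /tval /= -!/(tval _ _ _); apply: leq_add => //.
by have := loop_step c qL; case: ltP => // h1; case: ltP => //; lia.
Qed.

Lemma tval_col r al s (c i : int) : chain r al s ->
  (tval s c i <= tval s (c - 1) (i + 1))%N.
Proof.
elim: al r s => [|a al IH] r [|q s] //= [qL _ _ /IH le].
rewrite /tval /= -!/(tval _ _ _); apply: leq_add => //.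
by have := loop_stepP c qL; case: ltP => // h1; case: ltP => //; lia.
Qed.

(** Strips being horizontal, the upper box already lies in the next shape q. If the lower one does
    not, it is counted once more; if it does, the argument is repeated inside q. *)
Lemma tval_strict r al s (c i : int) : chain r al s -> inside r c i ->
  inside r (c - 1) (i + 1) -> (tval s c i < tval s (c - 1) (i + 1))%N.
Proof.
elim: al r s => [|a al IH] r [|q s] //=; first by move=> ->; rewrite /inside; lia.
move=> [qL hs _ cs] i1 i2; have := hs (c - 1); rewrite subrK => hsc.
have le := tval_col c i cs.
rewrite /tval /= -!/(tval _ _ _).
have -> : (q c < i) = false by move: i1 i2; rewrite /inside; lia.
have [lt|ge] := ltP (q (c - 1)) (i + 1); first by rewrite add1n ltnS.
by apply: IH cs _ _; move: i1 i2; rewrite /inside; lia.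
Qed.

Lemma tval_gt0 r al s (c i : int) : chain r al s -> inside r c i -> (0 < tval s c i)%N.
Proof.
elim: al r s => [|a al IH] r [|q s] //=; first by move=> ->; rewrite /inside; lia.
move=> [qL hs _ cs] i1; rewrite /tval /= -!/(tval _ _ _).
have [lt|ge] := ltP (q c) i; first by rewrite add1n.
by apply: IH cs _; move: i1; rewrite /inside; lia.
Qed.

Lemma tval_eq0 r al s (c i : int) : chain r al s -> i <= loop0 c -> tval s c i = 0%N.
Proof.
elim: al r s => [|a al IH] r [|q s] //= [qL hs _ cs] le.
rewrite /tval /= -!/(tval _ _ _) (IH _ _ cs le) addn0.
by have := chain_ge c cs; case: ltP => //; lia.
Qed.

Lemma tval_full r al s (c i : int) : chain r al s -> r c < i -> tval s c i = size s.
Proof.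
elim: al r s => [|a al IH] r [|q s] //= [qL hs _ cs] lt.
have lq : q c < i by have := hs c; lia.
by rewrite /tval /= -!/(tval _ _ _) lq (IH _ _ cs lq).
Qed.

(** The shapes are nested, so those that miss a box are the innermost ones; [rev s] lists them from
    the inside. *)
Lemma tval_level r al s (c i : int) (k : nat) : chain r al s -> (k < size s)%N ->
  (tval s c i <= k)%N = (i <= nth loop0 (rev s) k c).
Proof.
elim: al r s => [|a al IH] r [|q s] //= [qL hs _ cs] ks.
rewrite rev_cons nth_rcons size_rev /tval /= -!/(tval _ _ _).
have [lt|ge] := ltP (q c) i.
  rewrite (tval_full cs lt) add1n.
  case: (ltnP k (size s)) => h; last first.
    have kE : k = size s by apply/eqP; rewrite eqn_leq -ltnS ks.
    by rewrite kE ltnn eqxx leNgt lt.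
  have := IH _ _ cs h; rewrite (tval_full cs lt).
  by rewrite ltnNge (ltnW h) leqNgt h /= => <-.
rewrite add0n; case: (ltnP k (size s)) => h; first exact: IH cs h.
have kE : k = size s by apply/eqP; rewrite eqn_leq -ltnS ks.
by rewrite kE eqxx ge count_size.
Qed.

Definition cells r : seq (set (int * int)) :=
  [seq cell c%:Z (loop0 c%:Z + t.+1%:Z) | c : nat <- iota 0 n,
     t : nat <- iota 0 `|r c%:Z - loop0 c%:Z|%N].

Lemma mem_cells r x : loop r -> (forall c, loop0 c <= r c) ->
  (x \in cells r) <-> diag r x.
Proof.
move=> rL ge; split.
  move/allpairsPdep => [c [t [cn tn ->]]]; apply/diag_cell => //.
  by have := ge c%:Z; move: tn; rewrite mem_iota /inside; lia.
move=> /(diag_cellP rL) [c [i [-> ins]]]; apply/allpairsPdep.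
exists (c : nat), `|(i - loop0 c%:Z - 1)%R|%N; rewrite !mem_iota /=.
by move: ins; rewrite /inside => ins; split; [|lia|congr cell; lia].
Qed.

(** A representative of the class is chosen; by [tval_per] the value along a chain does not depend
    on it. *)
Definition tval_class s (x : set (int * int)) : nat :=
  let p := xget (0, 0) [set p | x = cell p.1 p.2]%classic in tval s p.1 p.2.

Definition tab_of r s : cyl_filling := [fsfun x in seq_fset tt (cells r) => tval_class s x].

Lemma tval_classE r al s (c i : int) : chain r al s -> tval_class s (cell c i) = tval s c i.
Proof.
move=> cs; rewrite /tval_class; set p := xget _ _.
have /cellP [k [e1 e2]] : cell c i = cell p.1 p.2.
  by apply: (@xgetPex _ (0, 0) [set p | cell c i = cell p.1 p.2]%classic); exists (c, i).
by rewrite e1 e2 -(tval_per _ _ _ cs) subrK.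
Qed.

Lemma tab_ofE r al s (c i : int) : loop r -> chain r al s -> inside r c i ->
  tab_of r s (cell c i) = tval s c i.
Proof.
move=> rL cs ins; rewrite fsfunE seq_fsetE.
have -> : cell c i \in cells r.
  by apply/mem_cells => //; [move=> d; apply: chain_ge cs|apply/diag_cell].
exact: tval_classE cs.
Qed.

Lemma tab_of_out r s x : loop r -> (forall c, loop0 c <= r c) -> ~ diag r x ->
  tab_of r s x = 0%N.
Proof.
by move=> rL ge nd; rewrite fsfunE seq_fsetE; case: ifP => // /(mem_cells _ rL ge).
Qed.

Lemma tab_of_tab r al s : loop r -> chain r al s -> tab r (tab_of r s).
Proof.
move=> rL cs; have ge c := chain_ge c cs; split=> [x|c i i1 i2|c i i1 i2].
- split=> [/(diag_cellP rL) [c [i [-> ins]]]|].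
    by rewrite (tab_ofE rL cs) //; apply: tval_gt0 cs ins.
  by apply: contraPP => nd; rewrite tab_of_out.
- by rewrite !(tab_ofE rL cs) //; apply: tval_row cs.
- by rewrite !(tab_ofE rL cs) //; apply: tval_strict cs i1 i2.
Qed.

Lemma tab_of_le r al s x : loop r -> chain r al s -> (tab_of r s x <= size s)%N.
Proof.
move=> rL cs; have ge c := chain_ge c cs.
have [dx|nd] := pselect (diag r x); last by rewrite tab_of_out.
have [c [i [-> ins]]] := diag_cellP rL dx.
by rewrite (tab_ofE rL cs) // count_size.
Qed.

Lemma levels_tab_of r al s (k : nat) : loop r -> chain r al s -> (k < size s)%N ->
  levels r (tab_of r s) k = nth loop0 (rev s) k.
Proof.
move=> rL cs ks; have tT := tab_of_tab rL cs.
have ge c := chain_ge c cs.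
apply/funext => c.
apply: (@levels_cut r _ rL tT ge k c (fun i : int => i <= nth loop0 (rev s) k c)) => // i.
rewrite -(tval_level _ _ cs ks); split.
  move=> [le|[ins]]; first by rewrite (tval_eq0 cs le).
  by rewrite (tab_ofE rL cs).
move=> le; have [l|l] := boolP (i <= loop0 c); [by left|right].
have ins : inside r c i.
  rewrite /inside ltNge l /= leNgt; apply/negP => lt.
  by move: le; rewrite (tval_full cs lt) leqNgt ks.
by rewrite (tab_ofE rL cs).
Qed.

Lemma gseq_levels r al s : loop r -> chain r al s ->
  gseq (levels r (tab_of r s)) (size s) = s.
Proof.
move=> rL cs; apply: (@eq_from_nth _ loop0); rewrite size_gseq // => j js.
rewrite nth_gseq // (levels_tab_of rL cs); last by lia.
by rewrite nth_rev; [congr nth; lia|lia].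
Qed.

Lemma filling_exp_eq0 (T : cyl_filling) (k : nat) :
  (forall x, (T x <= k)%N) -> filling_exp T k.+1 = 0%N.
Proof.
move=> le; rewrite /filling_exp; apply/eqP; rewrite -leqn0 leqNgt -has_count.
by apply/hasPn => x _; rewrite neq_ltn ltnS le.
Qed.

Lemma tab_levels_of r T N : loop r -> (forall c, loop0 c <= r c) -> tab r T ->
  (forall x, (T x <= N)%N) -> tab_of r (gseq (levels r T) N) = T.
Proof.
move=> rL ge tT TN; apply/fsfunP => x.
have [dx|nd] := pselect (diag r x); last first.
  rewrite tab_of_out //; apply/esym/eqP; rewrite -leqn0 leqNgt; apply/negP.
  by case: tT => /(_ x) [_ h] _ _ /h.
have [c [i [-> ins]]] := diag_cellP rL dx.
have cs : chain (levels r T N) (rev (mkseq (fun k : nat => filling_exp T k.+1) N))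
    (gseq (levels r T) N).
  apply: gseq_chain; [exact: levels0|exact: levels_loop|exact: levels_hstrip|exact: levels_sum].
rewrite (levels_top rL tT ge TN) in cs; rewrite (tab_ofE rL cs) //.
have h (k : nat) : (levels r T k c%:Z < i) = (k < T (cell c%:Z i))%N.
  rewrite ltNge ltnNge; congr (~~ _); apply/idP/idP.
    by move=> /(levelsP rL tT ge) [le|[//]]; move: ins; rewrite /inside; lia.
  by move=> le; apply/(levelsP rL tT ge); right.
have {}TN := TN (cell c%:Z i).
(* By [h] the levels that miss the box are those with k < T, for k = 0, ..., N - 1. *)
have -> : tval (gseq (levels r T) N) c%:Z i = minn (T (cell c%:Z i)) N.
  elim: (N) => [|N' IH]; first by rewrite minn0.
  rewrite /tval /= -/(tval _ _ _) IH h.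
  by case: ltnP => lt /=; rewrite /minn; do 2 case: ltnP; lia.
by rewrite (minn_idPl TN).
Qed.

Lemma tab_equipotent r (al : nat -> nat) N : loop r -> (forall c, loop0 c <= r c) ->
  (forall i : nat, (N <= i)%N -> al i = 0%N) ->
  equipotent (chains r (rev (mkseq al N)))
    [set T | tab r T /\ forall i : nat, filling_exp T i.+1 = al i]%classic.
Proof.
move=> rL ge aN; exists (tab_of r), (fun T => gseq (levels r T) N).
split=> [s cs|T [tT wT]].
  have sN : size s = N by rewrite (chain_size cs) size_rev size_mkseq.
  have tT := tab_of_tab rL cs; have gE := gseq_levels rL cs; rewrite sN in gE.
  split=> //; split=> // k.
  have Tle x := tab_of_le x rL cs; rewrite sN in Tle.
  have [kN|Nk] := ltnP k N; last first.
    by rewrite aN // filling_exp_eq0 // => x; apply: leq_trans (Tle x) _.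
  have cs' := cs; rewrite /chains /= -gE -{1}(levels_top rL tT ge Tle) in cs'.
  by have := chain_gseq_sum cs' kN; rewrite (levels_sum rL tT ge); lia.
(* A value above N would occur in T although the exponent of its variable is 0. *)
have TN x : (T x <= N)%N.
  rewrite leqNgt; apply/negP => lt; have := wT (T x).-1.
  rewrite prednK ?aN; [|lia|lia].
  move=> /eqP; rewrite /filling_exp -leqn0 leqNgt -has_count => /hasPn /(_ x).
  by rewrite mem_finsupp eqxx => /(_ ltac:(lia)).
split; last exact: tab_levels_of.
rewrite /chains /= -{1}(levels_top rL tT ge TN).
apply: gseq_chain; [exact: levels0|exact: levels_loop|exact: levels_hstrip|].
by move=> k; rewrite (levels_sum rL tT ge) wT.
Qed.

(** * Shapes *)

(** The whole regions left of the boundary are compared, boxes of the empty shape included, so that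
    each of s and r determines the other. *)
Definition shape_loop (s : cyl_shape m) r := forall i j : int,
  (j <= part_shift n s.1 s.2 i) = (i <= r (j - i)).

Lemma part_extE (la : m.-tuple nat) (e : nat) k : (e < m)%N ->
  part_ext n la (e%:Z + 1 + k * m%:Z) = (nth 0%N la e)%:Z - k * (n%:Z - m%:Z).
Proof.
move=> em; rewrite /part_ext.
have -> : e%:Z + 1 + k * m%:Z - 1 = k * m%:Z + e%:Z by lia.
rewrite modzMDl divzMDl; last by lia.
rewrite modz_small; last by lia.
by rewrite divz_small ?addr0 ?natB_int //; lia.
Qed.

Lemma row_divE (i : int) : exists (e : 'I_m) (k : int), i = e%:Z + 1 + k * m%:Z.
Proof. by have [e [k ek]] := int_divE (i - 1) m_gt0; exists e, k; lia. Qed.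

Lemma empty_partE (i j : int) :
  (j <= part_ext n (empty_part m) i) = (i <= loop0 (j - i)).
Proof.
have [e [k ->]] := row_divE i; have em := ltn_ord e.
rewrite part_extE // nth_nseq if_same.
have [e' [k' E]] := int_divE (j - (e%:Z + 1 + k * m%:Z)) n_gt0; rewrite E.
have en := ltn_ord e'; rewrite loop0E //.
have -> : j = e'%:Z + k' * n%:Z + (e%:Z + 1 + k * m%:Z) by lia.
(* The right side compares e + 1 + (k + k') m, with e + 1 in [1, m], to a number in [1 - m, 0]. Its
   truth is decided by size alone unless k + k' = -1. *)
have [Q|[Q|Q]] : (0 <= k + k') \/ (k + k' = -1) \/ (k + k' <= -2) by lia.
- nia.
- have -> : k' = -1 - k by lia.
  lia.
- nia.
Qed.

Lemma shape_diagram s r : shape_loop s r -> cyl_diagram n s = diag r.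
Proof.
move=> sr; rewrite /cyl_diagram /diag; congr image; apply/funext => -[i j] /=.
by rewrite -sr ltNge empty_partE -ltNge.
Qed.

Lemma shape_tab s r T : loop r -> shape_loop s r -> is_cyl_tableau n s T <-> tab r T.
Proof.
move=> rL sr; rewrite /is_cyl_tableau (shape_diagram sr) /tab.
split=> -[t0 t1 t2]; split=> //.
- move=> c i i1 i2; have := t1 i (i + c).
  have e1 : i + c - i = c by lia.
  have e2 : i + c + 1 - i = c + 1 by lia.
  by rewrite !cyl_classE e1 e2; apply; apply/diag_cell.
- move=> c i i1 i2; have := t2 i (i + c).
  have e1 : i + c - i = c by lia.
  have e2 : i + c - (i + 1) = c - 1 by lia.
  by rewrite !cyl_classE e1 e2; apply; apply/diag_cell.
- move=> i j; rewrite !cyl_classE (_ : j + 1 - i = j - i + 1); last by lia.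
  by move=> /(diag_cell _ _ rL) h1 /(diag_cell _ _ rL) h2; apply: t1.
- move=> i j; rewrite !cyl_classE (_ : j - (i + 1) = j - i - 1); last by lia.
  by move=> /(diag_cell _ _ rL) h1 /(diag_cell _ _ rL) h2; apply: t2.
Qed.

Lemma shape_loop_uniq s r r' : shape_loop s r -> shape_loop s r' -> r = r'.
Proof.
move=> h h'; apply/funext => c; apply: eq_cut => i.
by have := h i (c + i); rewrite h' addrK.
Qed.

Lemma part_ext_per (la : m.-tuple nat) (i : int) :
  part_ext n la (i + m%:Z) = part_ext n la i - (n%:Z - m%:Z).
Proof.
have [e [k ->]] := row_divE i; have em := ltn_ord e.
have -> : e%:Z + 1 + k * m%:Z + m%:Z = e%:Z + 1 + (k + 1) * m%:Z by lia.
by rewrite !part_extE //; lia.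
Qed.

Lemma part_ext_anti (la : m.-tuple nat) (i : int) : Pmn n la ->
  part_ext n la (i + 1) <= part_ext n la i.
Proof.
move=> [srt bnd]; have [e [k ->]] := row_divE i; have em := ltn_ord e.
rewrite (part_extE la k em).
have [em1|em1] : (e.+1 < m)%N \/ e.+1 = m by lia.
  have -> : e%:Z + 1 + k * m%:Z + 1 = e.+1%:Z + 1 + k * m%:Z by lia.
  rewrite part_extE //; have /(sortedP 0%N) := srt.
  by rewrite size_tuple => /(_ _ em1); lia.
have -> : e%:Z + 1 + k * m%:Z + 1 = 0%N%:Z + 1 + (k + 1) * m%:Z by lia.
rewrite part_extE //.
by have := all_nthP 0%N bnd 0%N; rewrite size_tuple => /(_ m_gt0); lia.
Qed.

Lemma part_ext_anti_le (la : m.-tuple nat) (i : int) (d : nat) : Pmn n la ->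
  part_ext n la i <= part_ext n la (i - d%:Z).
Proof.
move=> la_ok; elim: d => [|d IH]; first by rewrite subr0.
apply: le_trans IH _; have := part_ext_anti (i - d.+1%:Z) la_ok.
by rewrite (_ : i - d.+1%:Z + 1 = i - d%:Z); [|lia].
Qed.

Lemma loop_of_shape s : cyl_shapes n s ->
  exists2 r, loop r /\ (forall c, loop0 c <= r c) & shape_loop s r.
Proof.
case: s => la d; rewrite /cyl_shapes /= => la_ok; pose f (i : int) := part_shift n la d i - i.
have fP : qper m n f.
  move=> i; rewrite /f /part_shift (_ : i + m%:Z - d%:Z = i - d%:Z + m%:Z); last by lia.
  by rewrite part_ext_per; lia.
have fS (i : int) : f (i + 1) < f i.
  rewrite /f /part_shift (_ : i + 1 - d%:Z = i - d%:Z + 1); last by lia.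
  by have := part_ext_anti (i - d%:Z) la_ok; lia.
have [rL rK] := strict_loop fP fS.
have sl : shape_loop (la, d) (conjf f).
  move=> i j /=; rewrite -(loop_conjP _ _ rL) rK /f.
  by move: (part_shift _ _ _ _) => y; lia.
exists (conjf f) => //; split=> // c.
(* An empty row is no longer than the empty row d places above it, which in turn is within the row
   of lambda there; the shift adds d more columns. *)
have := sl (loop0 c) (c + loop0 c); rewrite addrK => <- /=.
apply: (@le_trans _ _ (part_ext n (empty_part m) (loop0 c))).
  by rewrite empty_partE addrK.
have e_ok : Pmn n (empty_part m).
  by split=> /=; [elim: (m) => // -[]|rewrite all_nseq orbT].
rewrite /part_shift; apply: le_trans (part_ext_anti_le _ d e_ok) _.
have [e [k ->]] := row_divE (loop0 c - d%:Z); have em := ltn_ord e.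
by rewrite !part_extE // nth_nseq if_same; lia.
Qed.

(* The boundary of lambda passes through the upper right corner of its
   m x (n - m) box, which lies on the diagonal of content n - m, in row 0;
   hence [d = r (n - m)]. *)
Lemma shape_of_loop r : loop r -> (forall c, loop0 c <= r c) ->
  exists2 s, cyl_shapes n s & shape_loop s r.
Proof.
move=> rL ge; pose B := conjf r; have BP := conj_per rL.
pose c0 := n%:Z - m%:Z; pose d := `|r c0|%N.
have dE : r c0 = d%:Z.
  by have := ge c0; rewrite /d loop0_small /c0; lia.
pose L (i : int) := B i + i.
have LS (i : int) : L (i + 1) <= L i by have := conj_strict i rL; rewrite /L /B; lia.
have LP (i : int) : L (i + m%:Z) = L i - (n%:Z - m%:Z) by rewrite /L /B BP; lia.
have LA (i : int) (k : nat) : L (i + k%:Z) <= L i.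
  elim: k => [|k IH]; first by rewrite addr0.
  by apply: le_trans IH; rewrite (_ : i + k.+1%:Z = i + k%:Z + 1) //; lia.
have LM (i k : int) : L (i + k * m%:Z) = L i - k * (n%:Z - m%:Z).
  by rewrite /L /B (qperM _ _ BP); lia.
have b1 : c0 <= B d%:Z by rewrite /B loop_conjP // dE.
have b2 : B (d%:Z + 1) < c0 by rewrite ltNge /B loop_conjP // dE; lia.
have lo (e : nat) : (e < m)%N -> d%:Z <= L (e%:Z + 1 + d%:Z).
  move=> em; have := LA (e%:Z + 1 + d%:Z) (m - e.+1)%N.
  rewrite (_ : e%:Z + 1 + d%:Z + (m - e.+1)%N%:Z = d%:Z + m%:Z); last by lia.
  by rewrite LP /L; move: b1; rewrite /c0; lia.
have hi (e : nat) : L (e%:Z + 1 + d%:Z) <= n%:Z - m%:Z + d%:Z.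
  have := LA (d%:Z + 1) e; rewrite (_ : d%:Z + 1 + e%:Z = e%:Z + 1 + d%:Z); last by lia.
  by rewrite {2}/L; move: b2; rewrite /c0; lia.
(* By [lo] these differences are nonnegative, so the absolute value changes nothing. *)
pose la : m.-tuple nat := [tuple `|(L (e%:Z + 1 + d%:Z) - d%:Z)%R|%N | e < m].
have laE (e : nat) : (e < m)%N -> (nth 0%N la e)%:Z = L (e%:Z + 1 + d%:Z) - d%:Z.
  move=> em; rewrite -(tnth_nth _ _ (Ordinal em)) tnth_mktuple /=.
  by have := lo e em; lia.
have la_ok : Pmn n la.
  split.
    apply/(sortedP 0%N) => e; rewrite size_tuple => em.
    have := laE e ltac:(lia); have := laE e.+1 em.
    have := LS (e%:Z + 1 + d%:Z).
    by rewrite (_ : e%:Z + 1 + d%:Z + 1 = e.+1%:Z + 1 + d%:Z); lia.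
  apply/(all_nthP 0%N) => e; rewrite size_tuple => em.
  by have := laE e em; have := hi e; lia.
exists (la, d) => // i j; rewrite /part_shift /=; have [e [k E]] := row_divE (i - d%:Z).
have em := ltn_ord e; rewrite E part_extE // laE // -(loop_conjP _ _ rL) -/B.
have := LM (e%:Z + 1 + d%:Z) k.
rewrite (_ : e%:Z + 1 + d%:Z + k * m%:Z = i); last by lia.
by rewrite {1}/L; move: (B i) (L _) => x y; lia.
Qed.

(** The box bound gives lambda_0 = lambda_m + (n - m) >= n - m >= lambda_1, so row d is the last one
    to reach content n - m. This recovers d from r, and then the parts. *)
Lemma shape_inj s s' r : cyl_shapes n s -> cyl_shapes n s' -> shape_loop s r ->
  shape_loop s' r -> s = s'.
Proof.
have dE (t : cyl_shape m) : cyl_shapes n t -> shape_loop t r -> r (n%:Z - m%:Z) = t.2%:Z.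
  case: t => la d; rewrite /cyl_shapes /= => -[_ bnd] sl.
  have h1 := sl d%:Z (n%:Z - m%:Z + d%:Z); rewrite addrK in h1.
  have h2 := sl (d%:Z + 1) (n%:Z - m%:Z + (d%:Z + 1)); rewrite addrK in h2.
  move: h1 h2; rewrite /part_shift /=.
  rewrite (_ : d%:Z - d%:Z = m.-1%:Z + 1 + (-1) * m%:Z); last by lia.
  rewrite (_ : d%:Z + 1 - d%:Z = 0%N%:Z + 1 + 0 * m%:Z); last by lia.
  rewrite !part_extE //; last by rewrite prednK.
  by have := all_nthP 0%N bnd 0%N; rewrite size_tuple => /(_ m_gt0); lia.
move=> sC sC' sl sl'; have e := dE _ sC sl; have e' := dE _ sC' sl'.
case: s s' sC sC' sl sl' e e' => la d [la' d'] /= _ _ sl sl' e e'.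
have dd : d = d' by lia.
congr pair => //; apply: val_inj; apply: (@eq_from_nth _ 0%N); rewrite ?size_tuple //.
move=> x xm; have : part_shift n la d (x%:Z + 1 + d%:Z) = part_shift n la' d (x%:Z + 1 + d%:Z).
  by apply: eq_cut => j; have := sl (x%:Z + 1 + d%:Z) j; rewrite /= dd => ->; rewrite -sl'.
rewrite /part_shift addrK (_ : x%:Z + 1 = x%:Z + 1 + 0 * m%:Z); last by lia.
by rewrite !part_extE // => /addIr /addIr [].
Qed.

Lemma diag_sub r r' : loop r -> loop r' -> (forall c, loop0 c <= r' c) ->
  (diag r `<=` diag r')%classic <-> forall c, r c <= r' c.
Proof.
move=> rL rL' ge'; split=> [sub c|le x /(diag_cellP rL) [c [i [-> ins]]]].
  have [lt|le] := ltP (loop0 c) (r c); last exact: le_trans le (ge' c).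
  have /sub : diag r (cell c (r c)) by apply/diag_cell => //; rewrite /inside lt lexx.
  by move/(diag_cell _ _ rL'); rewrite /inside => /andP [].
by apply/diag_cell => //; move: ins; rewrite /inside; have := le c%:Z; lia.
Qed.

(** * Weak order, and the map to shapes *)

Lemma ell_sgen i : ell (sgen i) = 1%N.
Proof.
have -> : sgen i = word_prod [:: i] by rewrite word_prod_cons /word_prod big_nil mulg1.
by rewrite ell_uniq.
Qed.

Lemma weak_le_loop (w v : affS n) : weak_le w v -> good v ->
  good w /\ forall c, wact w loop0 c <= wact v loop0 c.
Proof.
elim=> {w v} [w v [i [-> le]]|w|w u v _ IH1 _ IH2] gv //; last first.
  have [gu le2] := IH2 gv; have [gw le1] := IH1 gu.
  by split=> // c; apply: le_trans (le2 c).
have gw : good w by apply: (@good_suffix (sgen i)); rewrite // le ell_sgen.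
split=> // c; have [b [bE sb]] := reduced_exists w.
have : reduced_word (sgen i * w)%g (i :: b).
  by split; [rewrite word_prod_cons bE|rewrite le /= sb].
move=> /(good_adding gv) /(adding_cons _ _ loop0_loop) [bA iA].
have := adding_le c (lact_loop b loop0_loop) iA.
by rewrite -bE -word_prod_cons !wact_word.
Qed.

(** A word adding the missing boxes climbs from w to v; each of its letters is a cover, because the
    lengths of adding words are their sizes. *)
Lemma loop_weak_le (w v : affS n) : good w -> good v ->
  (forall c, wact w loop0 c <= wact v loop0 c) -> weak_le w v.
Proof.
move=> gw gv le; have wL := wact_loop w loop0_loop; have vL := wact_loop v loop0_loop.
have [a aA aE] := adding_exists wL vL le; have [b [bE sb]] := reduced_exists w.
have bA : adding loop0 b by apply: (good_adding gw).
have abA x : adding (wact w loop0) x -> adding loop0 (x ++ b).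
  by move=> xA; apply/adding_cat => //; rewrite -wact_word bE.
have -> : v = word_prod (a ++ b).
  have [g _] := adding_good (abA _ aA); apply: good_inj => //.
  by rewrite wact_word lact_cat -(wact_word b) bE aE.
elim: a aA {aE le gv v vL} => [|i a IH] aA; first by rewrite bE; apply: rt_refl.
have [aA' _] := proj1 (adding_cons _ _ wL) aA.
apply: rt_trans (IH aA') _; apply: rt_step; exists i; split.
  by rewrite cat_cons word_prod_cons.
by have [_ ->] := adding_good (abA _ aA); have [_ ->] := adding_good (abA _ aA').
Qed.

Definition shape_of (w : affS n) : cyl_shape m :=
  xget (empty_part m, 0%N) [set s | cyl_shapes n s /\ shape_loop s (wact w loop0)]%classic.

Lemma shape_ofP w : good w ->
  cyl_shapes n (shape_of w) /\ shape_loop (shape_of w) (wact w loop0).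
Proof.
move=> gw; have [s sC sl] := shape_of_loop (wact_loop w loop0_loop) (fun c => good_ge c gw).
pose P := [set s | cyl_shapes n s /\ shape_loop s (wact w loop0)]%classic.
by apply: (@xgetPex _ _ P); exists s.
Qed.

Lemma affine_schurE w : good w -> affine_stanley w = cyl_schur n (shape_of w).
Proof.
move=> gw; have [sC sl] := shape_ofP gw.
have rL := wact_loop w loop0_loop; have ge c := good_ge c gw.
apply/funext => al; apply: equipotent_card.
pose N := (\max_(j <- finsupp al) j).+1.
have aN (i : nat) : (N <= i)%N -> al i = 0%N.
  move=> Ni; apply: fsfun_dflt; apply/negP => fi.
  by have := @leq_bigmax_seq _ _ xpredT id _ fi isT; rewrite -ltnS -/N ltnNge Ni.
apply: equipotent_trans (is_fact_equipotent w aN) _.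
apply: equipotent_trans (facts_equipotent _ gw) _.
(* The first factor is the outermost strip and carries x_1, whereas in a tableau the outermost strip
   carries the largest entry. *)
apply: equipotent_trans (chains_rev _ rL) _.
apply: equipotent_trans (tab_equipotent rL ge aN) _.
rewrite (_ : [set T | _]%classic = [set T | is_cyl_tableau n (shape_of w) T /\
  forall i : nat, filling_exp T i.+1 = al i]%classic); first exact: equipotent_refl.
apply/funext => T; apply/propext; split=> -[h1 h2]; split=> //.
  exact/(shape_tab _ rL sl).
exact/(shape_tab _ rL sl).
Qed.

End Cylinder.

Local Close Scope ring_scope.
Local Open Scope classical_set_scope.

Theorem theorem7 (m n : nat) (m_gt0 : (0 < m)%N) (m_ltn : (m < n)%N) :
  exists phi : affS n -> cyl_shape m,
    [/\ set_bij (@A0set n m) (@cyl_shapes m n) phi,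
        forall w v : affS n, A0set m w -> A0set m v ->
          (cyl_diagram n (phi w) `<=` cyl_diagram n (phi v) <-> weak_le w v)
      & forall w : affS n, A0set m w ->
          affine_stanley w = cyl_schur n (phi w)].
Proof.
have AG w := A0_good m_gt0 m_ltn w.
exists (@shape_of m n); split; first split.
- by move=> w /AG /(shape_ofP m_gt0 m_ltn) [].
- move=> w v /set_mem /AG gw /set_mem /AG gv e.
  have [_ sw] := shape_ofP m_gt0 m_ltn gw; have [_ sv] := shape_ofP m_gt0 m_ltn gv.
  rewrite -e in sv; apply: (good_inj m_gt0 m_ltn gw gv).
  exact: shape_loop_uniq sw sv.
- move=> s sC; have [r [rL ge] sl] := loop_of_shape m_gt0 m_ltn sC.
  have [w gw wE] := good_exists m_gt0 m_ltn rL ge; exists w; first exact/AG.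
  have [sC' sl'] := shape_ofP m_gt0 m_ltn gw; rewrite wE in sl'.
  exact: (shape_inj m_gt0 m_ltn sC' sC sl' sl).
- move=> w v /AG gw /AG gv.
  have [_ sw] := shape_ofP m_gt0 m_ltn gw; have [_ sv] := shape_ofP m_gt0 m_ltn gv.
  have wL := wact_loop m_gt0 m_ltn w (loop0_loop m_gt0 m_ltn).
  have vL := wact_loop m_gt0 m_ltn v (loop0_loop m_gt0 m_ltn).
  rewrite (shape_diagram m_gt0 m_ltn sw) (shape_diagram m_gt0 m_ltn sv).
  rewrite (diag_sub m_gt0 m_ltn wL vL (fun c => good_ge m_gt0 m_ltn c gv)); split.
    exact: loop_weak_le.
  by move=> wv; have [_ le] := weak_le_loop m_gt0 m_ltn wv gv.
- by move=> w /AG; apply: affine_schurE.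
Qed.
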